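(* Let $\Gamma\subset\partial M$ be open and let $\tau\in C(\overline\Gamma)$ be real valued. Then $M(\Gamma,\tau)\setminus M^0(\Gamma,\tau)$ is of measure zero; in particular, the (topological) boundary of $M(\Gamma,\tau)$ is of measure zero.
   Context: $(M,g)$ is a $C^\infty$-smooth, compact and connected Riemannian manifold of dimension $n\ge2$ with nonempty boundary $\partial M$ and Riemannian distance $d$. Measure zero is meant with respect to the Riemannian volume measure of $(M,g)$. The closed and the open domain of influence are $$M(\Gamma,\tau)=\{x\in M:\text{there is } y\in\overline\Gamma\text{ such that } d(x,y)\le\tau(y)\},$$ $$M^0(\Gamma,\tau)=\{x\in M:\text{there is } y\in\Gamma\text{ such that } d(x,y)<\tau(y)\}.$$ The topological boundary is taken in the topological space $M$. *)

(* Defs.v *)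
From HB Require Import structures.
From mathcomp Require Import all_boot all_order all_algebra.
From mathcomp Require Import all_classical all_reals all_analysis.
Set Implicit Arguments.
Unset Strict Implicit.
Unset Printing Implicit Defensive.
Import Order.TTheory GRing.Theory Num.Theory.
Import numFieldNormedType.Exports.
Local Open Scope classical_set_scope.
Local Open Scope ring_scope.

(** * Smooth maps *)

(* [C_class k O f]: on the open set O, f is continuous and has iterated
   directional derivatives up to order k, all of them continuous.  It is used
   only for V finite-dimensional, where this is the usual class C^k. *)
Fixpoint C_class (R : realType) (V W : normedModType R) (k : nat) (O : set V)
    (f : V -> W) : Prop :=
  (forall x, O x -> {for x, continuous f}) /\
  match k with
  | 0 => True
  | k'.+1 => forall v : V,
      (forall x, O x -> derivable f x v) /\ C_class k' O ('D_v f)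
  end.

Definition smooth (R : realType) (V W : normedModType R) (O : set V)
    (f : V -> W) : Prop :=
  forall k, C_class k O f.

(* [smooth_in D phi f]: on D, the map f is a smooth function of phi, that is,
   "f \o phi^-1 is smooth on phi @` D", where phi @` D need not be open (subset
   of a half-space, compact interval): smoothness at a point means that there
   is a smooth extension to an open neighbourhood of this point. *)
Definition smooth_in (R : realType) (T : Type) (V W : normedModType R)
    (D : set T) (phi : T -> V) (f : T -> W) : Prop :=
  forall x, D x -> exists (O : set V) (F : V -> W),
    [/\ open O, O (phi x), smooth O F &
        forall y, D y -> O (phi y) -> f y = F (phi y)].

(** * Smooth manifolds with boundary *)

(* The condition on i singles out the coordinate of index 0; it is phrased in
   this way because 'I_n has no canonical element for a variable n. *)
Definition half_space (R : realType) (n : nat) : set 'rV[R]_n :=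
  [set x | forall i : 'I_n, i = 0%N :> nat -> 0 <= x ord0 i].

Definition half_space_boundary (R : realType) (n : nat) : set 'rV[R]_n :=
  [set x | exists2 i : 'I_n, i = 0%N :> nat & x ord0 i = 0].

(* An atlas need not be maximal.  Fields [coord_inj], [coord_continuous] and
   [coord_open] say that [coord i] restricts to a homeomorphism from [dom i]
   onto a relatively open subset of the half-space; the values of [coord i]
   outside of [dom i] are irrelevant. *)
Record smooth_manifold (R : realType) (n : nat) (M : topologicalType) := {
  chart : Type ;
  dom : chart -> set M ;
  coord : chart -> M -> 'rV[R]_n ;
  manifold_hausdorff : hausdorff_space M ;
  manifold_second_countable : @second_countable M ;
  dom_open : forall i, open (dom i) ;
  dom_cover : forall x, exists i, dom i x ;
  coord_inj : forall i, {in dom i &, injective (coord i)} ;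
  coord_continuous : forall i, {within dom i, continuous (coord i)} ;
  coord_open : forall i (U : set M), open U -> U `<=` dom i ->
    exists2 O : set 'rV[R]_n,
      open O & coord i @` U = O `&` @half_space R n ;
  transition_smooth : forall i j,
    smooth_in (dom i `&` dom j) (coord i) (coord j) }.

Definition manifold_boundary (R : realType) (n : nat) (M : topologicalType)
    (X : smooth_manifold R n M) : set M :=
  [set x | exists2 i : chart X,
     dom i x & @half_space_boundary R n (coord i x)].

(** * Riemannian metrics *)

Definition bilin (R : realType) (n : nat) (A : 'M[R]_n) (v w : 'rV[R]_n) : R :=
  (v *m A *m w^T) ord0 ord0.

(* [tensor i q] is the matrix (g_ab) of the metric in the coordinates of the
   chart i at the point of coordinates q; its values outside of
   [coord i @` dom i] are irrelevant.  In [tensor_change], F is any smooth local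
   extension of the transition map from i to j; such extensions exist by
   [transition_smooth], and their derivative at [coord i x] is determined
   by the transition map, also when x is a boundary point. *)
Record riemannian_metric (R : realType) (n : nat) (M : topologicalType)
    (X : smooth_manifold R n M) := {
  tensor : chart X -> 'rV[R]_n -> 'M[R]_n ;
  tensor_smooth : forall i,
    smooth_in (dom i) (coord i) (fun x => tensor i (coord i x)) ;
  tensor_sym : forall i x, dom i x ->
    (tensor i (coord i x))^T = tensor i (coord i x) ;
  tensor_pos : forall i x v, dom i x -> v != 0 ->
    0 < bilin (tensor i (coord i x)) v v ;
  tensor_change : forall (i j : chart X) (x : M) (O : set 'rV[R]_n)
      (F : 'rV[R]_n -> 'rV[R]_n),
    dom i x -> dom j x -> open O -> O (coord i x) -> smooth O F ->
    (forall y, dom i y -> dom j y -> O (coord i y) ->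
      coord j y = F (coord i y)) ->
    forall v w, bilin (tensor i (coord i x)) v w =
      bilin (tensor j (coord j x))
        ('D_v F (coord i x)) ('D_w F (coord i x)) }.

(** * Riemannian distance *)

Definition smooth_curve (R : realType) (n : nat) (M : topologicalType)
    (X : smooth_manifold R n M) (a b : R) (c : R -> M) : Prop :=
  {within `[a, b], continuous c} /\
  forall i : chart X,
    smooth_in (`[a, b] `&` c @^-1` dom i) (fun t : R => t) (coord i \o c).

(* The breakpoints are 0 < s_1 < ... < s_m = 1; c is irrelevant outside of
   [0, 1]. *)
Definition piecewise_smooth_curve (R : realType) (n : nat)
    (M : topologicalType) (X : smooth_manifold R n M) (c : R -> M) : Prop :=
  exists s : seq R,
    [/\ path <%R 0 s, last 0 s = 1 &
        forall k, (k < size s)%N ->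
          smooth_curve X (nth 0 (0 :: s) k) (nth 0 (0 :: s) k.+1) c].

(* The norm of c'(t), computed in a chart around c(t): by [tensor_change] all
   charts yield the same value at every t which is not a breakpoint.  The
   breakpoints do not contribute to the length. *)
Definition speed (R : realType) (n : nat) (M : topologicalType)
    (X : smooth_manifold R n M) (g : riemannian_metric X) (c : R -> M)
    (t : R) : R :=
  xget 0 [set r | exists2 i : chart X, dom i (c t) &
    r = Num.sqrt (bilin (tensor g i (coord i (c t)))
                    ((coord i \o c)^`()%classic t)
                    ((coord i \o c)^`()%classic t))].

Definition curve_length (R : realType) (n : nat) (M : topologicalType)
    (X : smooth_manifold R n M) (g : riemannian_metric X) (c : R -> M) : \bar R
  := (\int[@lebesgue_measure R]_(t in `[0%R, 1%R]) (speed g c t)%:E)%E.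

Definition riemannian_dist (R : realType) (n : nat) (M : topologicalType)
    (X : smooth_manifold R n M) (g : riemannian_metric X) (x y : M) : \bar R :=
  ereal_inf [set curve_length g c | c in
    [set c | [/\ piecewise_smooth_curve X c, c 0 = x & c 1 = y]]].

(** * Riemannian volume measure *)

Definition borel (T : ptopologicalType) := g_sigma_algebraType (@open T).

(* The Lebesgue measure of R^n is the only Borel measure which has the usual
   values on boxes. *)
Definition is_lebesgue (R : realType) (n : nat)
    (lam : {measure set (borel 'rV[R]_n) -> \bar R}) : Prop :=
  forall a b : 'rV[R]_n, (forall i, a ord0 i <= b ord0 i) ->
    lam [set x : 'rV[R]_n | forall i, a ord0 i <= x ord0 i <= b ord0 i] =
      (\prod_(i < n) (b ord0 i - a ord0 i))%:E.

(* dV = sqrt (det (g_ab)) dx in every chart, which determines the Borel measure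
   vol. *)
Definition is_riemannian_volume (R : realType) (n : nat)
    (M : ptopologicalType) (X : smooth_manifold R n M)
    (g : riemannian_metric X) (vol : {measure set (borel M) -> \bar R}) : Prop :=
  exists2 lam : {measure set (borel 'rV[R]_n) -> \bar R}, is_lebesgue lam &
    forall (i : chart X) (A : set (borel M)), measurable A -> A `<=` dom i ->
      vol A = (\int[lam]_(q in (coord i @` A : set (borel 'rV[R]_n)))
                 (Num.sqrt (\det (tensor g i q)))%:E)%E.

(** * Domains of influence *)

Definition closed_influence (R : realType) (n : nat) (M : topologicalType)
    (X : smooth_manifold R n M) (g : riemannian_metric X)
    (Gamma : set M) (tau : M -> R) : set M :=
  [set x | exists2 y, closure Gamma y & (riemannian_dist g x y <= (tau y)%:E)%E].

Definition open_influence (R : realType) (n : nat) (M : topologicalType)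
    (X : smooth_manifold R n M) (g : riemannian_metric X)
    (Gamma : set M) (tau : M -> R) : set M :=
  [set x | exists2 y, Gamma y & (riemannian_dist g x y < (tau y)%:E)%E].

Definition topological_boundary (T : topologicalType) (A : set T) : set T :=
  closure A `\` interior A.

(* Main.v *)
From mathcomp Require Import all_boot all_order all_algebra.
From mathcomp Require Import all_classical all_reals all_analysis.
From mathcomp Require Import measurable_realfun.
From mathcomp Require Import ring lra.
Require Import Defs.
Set Implicit Arguments.
Unset Strict Implicit.
Unset Printing Implicit Defensive.
Import Order.TTheory GRing.Theory Num.Theory.
Import numFieldNormedType.Exports.
Local Open Scope classical_set_scope.
Local Open Scope ring_scope.



(** The reason is porosity. Let E be the difference of the two domains of influence, let x be a
    point of E interior to M, and let y in the closure of Gamma satisfy d(x, y) <= tau y. As y is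
    not an interior point, a nearly minimizing curve from x to y must leave the coordinate ball of
    radius r about x, at some z. In coordinates the Riemannian norm lies between m |v| and k |v|, so
    the curve has length at least m r before z. Points within coordinate distance th r of z, where k
    th <= m / 2, reach z at cost at most m r / 2; they are therefore strictly closer to y than tau
    y. By continuity of tau and of the distance they lie in the open domain of influence
    ([open_influence_closure]), hence outside E. So E has, near each of its interior points and at
    every small scale r, a hole of size comparable to r, with locally uniform constants
    ([influence_difference_porous]).

    A bounded uniformly porous set is Lebesgue null. If a cube is cut into sufficiently many equal
    cells, one of them misses the set; repeating this in the remaining cells multiplies the covering
    volume by a fixed factor below 1 at each stage ([porous_cell], [porous_cover],
    [porous_negligible]).

    The volume has a density in charts, so sets with Lebesgue null coordinate images are null
    ([negligible_chart]), and second countability makes nullity a local property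
    ([negligible_local]). Points that are not interior have coordinates in a hyperplane, in every
    chart, and form a null set too ([negligible_manifold_boundary]). Finally, compactness of M makes
    the closed domain of influence closed, while the open one is open and contained in it; so the
    topological boundary lies in E ([boundary_influence_sub]). *)

(** * Matrix norms and directional derivatives *)

Lemma ler_mx_norm_entry (R : realType) m n (A : 'M[R]_(m, n)) i j :
  `|A i j| <= `|A|.
Proof.
rewrite [leRHS]/Num.Def.normr/= mx_normrE.
exact: (le_bigmax _ (fun ij => `|A ij.1 ij.2|) (i, j)).
Qed.

Lemma mx_norm_leP (R : realType) m n (A : 'M[R]_(m, n)) e :
  0 <= e -> (forall i j, `|A i j| <= e) -> `|A| <= e.
Proof.
move=> e0 H; rewrite [leLHS]/Num.Def.normr/= mx_normrE.
by apply: bigmax_le => // -[i j] _ /=; exact: H.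
Qed.

Section lines.
Variables (R : realType) (V W : normedModType R).

Let line_quotient (f : V -> W) (p v : V) (s u : R) :
  (fun h : R => h^-1 *: (((fun s : R => f (s *: v + p)) \o shift s) (h *: u)
     - f (s *: v + p))) =
  (fun h => h^-1 *: ((f \o shift (s *: v + p)) (h *: (u *: v)) -
     f (s *: v + p))).
Proof.
apply/funext => h /=; congr (_ *: (f _ - _)).
by rewrite scalerDl addrA scalerA.
Qed.

Lemma derivable_lineE (f : V -> W) (p v : V) (s u : R) :
  derivable (fun s : R => f (s *: v + p)) s u =
  derivable f (s *: v + p) (u *: v).
Proof. by rewrite /derivable line_quotient. Qed.

Lemma derive_line (f : V -> W) (p v : V) (s u : R) :
  'D_u (fun s : R => f (s *: v + p)) s = 'D_(u *: v) f (s *: v + p).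
Proof. by rewrite /derive line_quotient. Qed.

Lemma is_derive_line (f : V -> W) (p v : V) (s : R) :
  derivable f (s *: v + p) v ->
  is_derive s 1 (fun s : R => f (s *: v + p)) ('D_v f (s *: v + p)).
Proof.
move=> fv; split; first by rewrite derivable_lineE scale1r.
by rewrite derive_line scale1r.
Qed.

Lemma continuous_line (p v : V) : continuous (fun s : R => s *: v + p).
Proof.
move=> s; apply: cvgD; last exact: cvg_cst.
by apply: cvgZr_tmp; exact: cvg_id.
Qed.

(** The derivative of the restricted map in direction [u] is the restriction of ['D_(u *: v) f],
    again a derivative in a fixed direction; this drives the induction on [k]. *)
Lemma C_class_line k (O : set V) (f : V -> W) (p v : V) :
  C_class k O f ->
  C_class k ((fun s : R => s *: v + p) @^-1` O) (fun s : R => f (s *: v + p)).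
Proof.
elim: k f => [|k ih] f [cf Df]; split => //=.
- move=> s Os; apply: (continuous_comp (@continuous_line _ _ _)); exact: cf.
- move=> s Os; apply: (continuous_comp (@continuous_line _ _ _)); exact: cf.
- move=> u; have [dv Cv] := Df (u *: v); split.
    by move=> s Os; rewrite derivable_lineE; exact: dv.
  rewrite (_ : 'D_u _ = fun s => 'D_(u *: v) f (s *: v + p)); first exact: (ih ('D_(u *: v) f)).
  by apply/funext => s; exact: derive_line.
Qed.

End lines.

Lemma smooth_line (R : realType) (V W : normedModType R) (O : set V)
    (f : V -> W) (p v : V) :
  smooth O f ->
  smooth ((fun s : R => s *: v + p) @^-1` O) (fun s : R => f (s *: v + p)).
Proof. by move=> sf k; apply: C_class_line; exact: sf. Qed.

Lemma MVT_line (R : realType) (V : normedModType R) (f : V -> R) (p v : V) :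
  (forall s, 0 <= s <= 1 -> derivable f (s *: v + p) v) ->
  exists2 s, 0 <= s <= 1 & f (v + p) - f p = 'D_v f (s *: v + p).
Proof.
move=> fv.
have [||s] := @MVT_segment _ (fun s : R => f (s *: v + p))
    (fun s => 'D_v f (s *: v + p)) 0 1 ler01.
- by move=> s /[!in_itv]/= /andP[s0 s1]; apply: is_derive_line; apply: fv;
    rewrite !ltW.
- apply: derivable_within_continuous => s; rewrite in_itv => s01.
  by apply: ex_derive; apply: is_derive_line; exact: fv.
rewrite in_itv/= => s01; rewrite scale1r scale0r add0r subr0 mulr1 => ->.
by exists s.
Qed.

(** Rescaling a direction only concerns the one-variable map [s |-> f (s *: v + p)], for which
    derivability amounts to differentiability; [h = 0] is covered. *)
Lemma derivableZdir (R : realType) (V W : normedModType R) (f : V -> W) (p v : V)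
    (h : R) : derivable f p v -> derivable f p (h *: v).
Proof.
have := derivable_lineE f p v 0 1; rewrite scale0r add0r scale1r => <- fv.
have := derivable_lineE f p v 0 h; rewrite scale0r add0r => <-.
by apply: diff_derivable; exact/derivable1_diffP.
Qed.

Lemma deriveZdir (R : realType) (V W : normedModType R) (f : V -> W) (p v : V)
    (h : R) : derivable f p v -> 'D_(h *: v) f p = h *: 'D_v f p.
Proof.
have := derivable_lineE f p v 0 1; rewrite scale0r add0r scale1r => <- fv.
have := derive_line f p v 0 h; rewrite scale0r add0r => <-.
have := derive_line f p v 0 1; rewrite scale0r add0r scale1r => <-.
have {}fv : differentiable (fun s : R => f (s *: v + p)) 0.
  exact/derivable1_diffP.
by rewrite !deriveE// -[in LHS](mulr1 h) [LHS]linearZ.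
Qed.

(** The difference quotient along [v + w] minus the one along [v] is the increment of [f] from
    [h *: v + p] in direction [h *: w], divided by [h]. By the mean value theorem it is a value of
    ['D_w f] near [p], and ['D_w f] is continuous at [p]. *)
Lemma deriveDdir (R : realType) (V : normedModType R) (f : V -> R) (p v w : V) :
  (\forall q \near p, derivable f q w) -> {for p, continuous ('D_w f)} ->
  derivable f p v -> derivable f p (v + w) ->
  'D_(v + w) f p = 'D_v f p + 'D_w f p.
Proof.
move=> fw cw fv fvw; apply/eqP; rewrite [X in _ == X]addrC -subr_eq; apply/eqP.
pose g (h : R) := h^-1 *: ((f \o shift p) (h *: (v + w)) - f p) -
  h^-1 *: ((f \o shift p) (h *: v) - f p).
have gl : g @ 0^' --> 'D_(v + w) f p - 'D_v f p by apply: cvgB; [exact: fvw|exact: fv].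
suff gw : g @ 0^' --> 'D_w f p.
  have E1 := cvg_lim (@norm_hausdorff _ _) gl.
  have E2 := cvg_lim (@norm_hausdorff _ _) gw.
  by rewrite -E2 -E1.
apply/cvgrPdist_le => e e0.
have /nbhs_ballP[d /= d0 dP] : \forall q \near p,
    derivable f q w /\ `|'D_w f p - 'D_w f q| <= e.
  near=> q; split; first by near: q.
  by near: q; move/cvgrPdist_le : cw; exact.
have vw0 : 0 < `|v| + `|w| + 1 by rewrite ltr_wpDl// addr_ge0.
near=> h.
have h0 : h != 0 by near: h; exact: nbhs_dnbhs_neq.
have hd : `|h| < d / (`|v| + `|w| + 1).
  by near: h; apply: dnbhs0_lt; rewrite divr_gt0.
have inb s : 0 <= s <= 1 -> ball p d (s *: (h *: w) + (h *: v + p)).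
  move=> /andP[s0 s1]; rewrite -ball_normE/= addrA opprD addrCA subrr addr0.
  rewrite normrN (le_lt_trans (ler_normD _ _))// !normrZ.
  move: hd; rewrite ltr_pdivlMr// => /(le_lt_trans _); apply.
  rewrite (ger0_norm s0) mulrDr mulr1 ler_wpDr// mulrDr addrC lerD//.
  by rewrite ler_piMl// mulr_ge0.
have fwq s : 0 <= s <= 1 -> derivable f (s *: (h *: w) + (h *: v + p)) w.
  by move=> /inb/dP[].
have [s s01 fE] := @MVT_line _ _ f (h *: v + p) (h *: w)
  (fun s s01 => derivableZdir (fwq s s01)).
rewrite (_ : g h = 'D_w f (s *: (h *: w) + (h *: v + p)));
  first by have [] := dP _ (inb _ s01).
rewrite /g -scalerBr /= opprB addrA subrK.
rewrite [h *: (v + w)]scalerDr [h *: v + h *: w]addrC -[X in f X]addrA fE deriveZdir; last exact: fwq.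
by rewrite scalerA mulVf// scale1r.
Unshelve. all: by end_near. Qed.

Lemma ler_mulmx_norm (R : realType) m n p (A : 'M[R]_(m, n)) (B : 'M[R]_(n, p)) :
  `|A *m B| <= n%:R * (`|A| * `|B|).
Proof.
apply: mx_norm_leP => [|i j]; first by rewrite mulr_ge0// mulr_ge0.
rewrite mxE (le_trans (ler_norm_sum _ _ _))//.
apply: (@le_trans _ _ (\sum_(k < n) `|A| * `|B|)).
  by apply: ler_sum => k _; rewrite normrM ler_pM// ler_mx_norm_entry.
by rewrite sumr_const card_ord mulr_natl.
Qed.

Lemma lipschitz_bound_continuous (R : realType) (V W : normedModType R)
    (f : V -> W) (k : R) :
  (forall x y, `|f x - f y| <= k * `|x - y|) -> continuous f.
Proof.
move=> fk x; apply/cvgrPdist_le => e e0; near=> y.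
apply: (le_trans (fk _ _)); apply: (@le_trans _ _ ((`|k| + 1) * `|x - y|)).
  by rewrite ler_wpM2r// ler_wpDr// ler_norm.
rewrite mulrC -ler_pdivlMr ?ltr_wpDl//; near: y.
by apply: cvgr_dist_le; [exact: cvg_id|rewrite divr_gt0// ltr_wpDl].
Unshelve. all: by end_near. Qed.

Lemma continuous_mulmxr (R : realType) m n p (B : 'M[R]_(n, p)) :
  continuous (fun A : 'M[R]_(m, n) => A *m B).
Proof.
apply: (@lipschitz_bound_continuous _ _ _ _ (n%:R * `|B|)) => A A'.
by rewrite -mulmxBl (le_trans (ler_mulmx_norm _ _))// mulrAC mulrA.
Qed.

(** * Differentiability of maps of class C^1 *)

Section C1.
Variables (R : realType) (n : nat).
Implicit Types (O : set 'rV[R]_n) (p v : 'rV[R]_n).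

Lemma C1_derive_sum O (f : 'rV[R]_n -> R) p v : open O -> O p ->
  C_class 1 O f -> 'D_v f p = \sum_k v ord0 k * 'D_(delta_mx ord0 k) f p.
Proof.
move=> oO Op [cf Df]; rewrite [in LHS](row_sum_delta v).
elim/big_rec2 : _ => [|k u a _ <-]; first by rewrite derive0.
have [dk [ck _]] := Df (delta_mx ord0 k).
rewrite addrC deriveDdir.
- by rewrite deriveZdir; [rewrite [LHS]addrC|exact: dk].
- have : nbhs p O by exact: open_nbhs_nbhs.
  apply: filterS => q Oq.
  by have [H _] := Df (v ord0 k *: delta_mx ord0 k); exact: H.
- have [_ [H _]] := Df (v ord0 k *: delta_mx ord0 k); exact: H.
- by have [H _] := Df a; exact: H.
- by have [H _] := Df (a + v ord0 k *: delta_mx ord0 k); exact: H.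
Qed.

Lemma C1_entry m O (F : 'rV[R]_n -> 'rV[R]_m) j : open O -> C_class 1 O F ->
  C_class 1 O (fun q => F q ord0 j).
Proof.
move=> oO [cF DF]; split=> [q Oq|v].
  exact: (@continuous_comp _ _ _ F (fun A : 'rV[R]_m => A ord0 j) q (cF q Oq)
    (@matrix_normedtype.coord_continuous _ _ _ _ _ _)).
have [dv [cv _]] := DF v; split=> [q Oq|].
  by have /derivable_mxP := dv q Oq; exact.
split=> // q Oq.
have DE q' : O q' -> 'D_v (fun q => F q ord0 j) q' = 'D_v F q' ord0 j.
  by move=> Oq'; rewrite derive_mx ?mxE//; exact: dv.
rewrite /prop_for /continuous_at DE//.
have : (fun q' : 'rV[R]_n => 'D_v F q' ord0 j) @ q --> 'D_v F q ord0 j.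
  exact: (@continuous_comp _ _ _ ('D_v F) (fun A : 'rV[R]_m => A ord0 j) q
    (cv q Oq) (@matrix_normedtype.coord_continuous _ _ _ _ _ _)).
apply: cvg_trans; apply: (@near_eq_cvg _ _ _ (nbhs_filter q)).
near=> q'; rewrite DE//; near: q'; exact: open_nbhs_nbhs.
Unshelve. all: by end_near.
Qed.

(** By the mean value theorem each entry of the increment [F (u + p) - F p] is a derivative in
    direction [u] at an intermediate point, that is, a combination of partial derivatives there. By
    continuity these are close to the partial derivatives at [p] collected in [J]. *)
Lemma C1_differentiable m O (F : 'rV[R]_n -> 'rV[R]_m) p : open O -> O p ->
  C_class 1 O F -> differentiable F p.
Proof.
move=> oO Op CF.
pose f j := fun q => F q ord0 j.
have Cf j : C_class 1 O (f j) by exact: C1_entry.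
pose J := \matrix_(k, j) 'D_(delta_mx ord0 k) (f j) p.
have cJ : continuous (mulmxr J : 'rV[R]_n -> 'rV[R]_m).
  exact: continuous_mulmxr.
have FJ : F \o shift p = cst (F p) + mulmxr J +o_ (0 : 'rV[R]_n) id.
  apply/eqaddoP => e e0.
  (* The sum of [n] errors of this size stays below [e], and the divisor is nonzero even for
     [n = 0]. *)
  have en0 : 0 < e / n.+1%:R by rewrite divr_gt0.
  have /nbhs_ballP[d /= d0 dP] : \forall q \near p, O q /\ forall j k,
      `|'D_(delta_mx ord0 k) (f j) p - 'D_(delta_mx ord0 k) (f j) q| <=
         e / n.+1%:R.
    apply: (@filterI _ _ (nbhs_filter p)); first exact: open_nbhs_nbhs.
    apply: (@filter_forall _ _ _ _ (nbhs_filter p)) => j.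
    apply: (@filter_forall _ _ _ _ (nbhs_filter p)) => k.
    have [_ Dj] := Cf j; have [_ [ck _]] := Dj (delta_mx ord0 k).
    by have /(@cvgrPdist_le _ _ _ _ (nbhs_filter p)) := ck p Op; exact.
  near=> u.
  have ud : `|u| < d by near: u; exact: (@nbhs0_lt _ 'rV[R]_n).
  have inb s : 0 <= s <= 1 -> ball p d (s *: u + p).
    move=> /andP[s0 s1]; rewrite -ball_normE/= opprD addrCA subrr addr0.
    by rewrite normrN normrZ (le_lt_trans _ ud)// ger0_norm// ler_piMl.
  apply: mx_norm_leP => [|i j]; first by rewrite mulr_ge0// ltW.
  rewrite (ord1 i) !mxE/=.
  have [s s01 fE] := @MVT_line _ _ (f j) p u
    (fun s s01 => ((Cf j).2 u).1 _ (dP _ (inb s s01)).1).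
  rewrite opprD addrA -[_ - F p ord0 j]/(f j (u + p) - f j p) fE.
  rewrite (@C1_derive_sum O)//; last by have [] := dP _ (inb s s01).
  rewrite -sumrB; under eq_bigr do rewrite mxE -mulrBr.
  rewrite (le_trans (ler_norm_sum _ _ _))//.
  apply: (@le_trans _ _ (\sum_(k < n) `|u| * (e / n.+1%:R))).
    apply: ler_sum => k _; rewrite normrM ler_pM ?ler_mx_norm_entry// distrC.
    by have [_] := dP _ (inb s s01); exact.
  rewrite sumr_const card_ord mulrC -mulrnAl ler_wpM2r// -mulr_natr -mulrA.
  by rewrite ler_piMr ?(ltW e0)// mulrC ler_pdivrMr// mul1r ler_nat.
apply/diff_locallyP; rewrite (diff_unique cJ FJ); split => //.
Unshelve. all: by end_near. Qed.

Lemma C1_derive_comp m O (F : 'rV[R]_n -> 'rV[R]_m) (c : R -> 'rV[R]_n) t :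
  open O -> O (c t) -> C_class 1 O F -> derivable c t 1 ->
  is_derive t 1 (F \o c) ('D_('D_1 c t) F (c t)).
Proof.
move=> oO Oct CF /derivable1_diffP dc.
have dF : differentiable F (c t) by exact: C1_differentiable CF.
split; first by apply/derivable1_diffP; exact: differentiable_comp.
rewrite (deriveE _ (differentiable_comp dc dF)) (diff_comp dc dF) /=.
by rewrite (deriveE _ dc) (deriveE _ dF).
Qed.

Lemma C1_derive_mulmx O (F : 'rV[R]_n -> 'rV[R]_n) p : open O -> O p ->
  C_class 1 O F -> exists J : 'M[R]_n, forall v, 'D_v F p = v *m J.
Proof.
move=> oO Op CF; exists (lin1_mx ('d F p)) => v.
by rewrite mul_rV_lin1 deriveE//; exact: C1_differentiable CF.
Qed.

End C1.


(** * Bilinear forms compared with the norm *)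

Section bilin.
Variables (R : realType) (n : nat).
Implicit Types (A B : 'M[R]_n) (v w : 'rV[R]_n).

Lemma ler_norm_bilin A v w :
  `|bilin A v w| <= n%:R ^+ 2 * `|A| * (`|v| * `|w|).
Proof.
rewrite (le_trans (ler_mx_norm_entry _ _ _))//.
apply: (le_trans (ler_mulmx_norm _ _)).
have trw : `|w^T| <= `|w|.
  by apply: mx_norm_leP => // i j; rewrite mxE ler_mx_norm_entry.
apply: (@le_trans _ _ (n%:R * ((n%:R * (`|v| * `|A|)) * `|w|))).
  by rewrite ler_wpM2l// ler_pM// ler_mulmx_norm.
by rewrite le_eqVlt; apply/orP; left; apply/eqP; ring.
Qed.

Lemma bilinBl A B v w : bilin (A - B) v w = bilin A v w - bilin B v w.
Proof. by rewrite /bilin mulmxBr mulmxBl !mxE. Qed.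

Lemma bilinZ A v k : bilin A (k *: v) (k *: v) = k ^+ 2 * bilin A v v.
Proof. by rewrite /bilin linearZ/= -!scalemxAl -scalemxAr !mxE mulrA. Qed.

Lemma bilinE A v w : bilin A v w = \sum_j (\sum_k v ord0 k * A k j) * w ord0 j.
Proof. by rewrite /bilin !mxE; apply: eq_bigr => j _; rewrite !mxE. Qed.

Lemma continuous_sum (T : topologicalType) m (f : 'I_m -> T -> R) t :
  (forall i, {for t, continuous (f i)}) ->
  {for t, continuous (fun s => \sum_i f i s)}.
Proof.
move=> cf; rewrite -fct_sumE; elim/big_ind : _ => //.
- exact: cst_continuous.
- by move=> g h cg ch; exact: continuousD.
Qed.

Lemma continuous_bilin (T : topologicalType) (A : T -> 'M[R]_n)
    (v : T -> 'rV[R]_n) t : {for t, continuous A} -> {for t, continuous v} ->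
  {for t, continuous (fun s => bilin (A s) (v s) (v s))}.
Proof.
move=> cA cv.
have cvk k : {for t, continuous (fun s => v s ord0 k)}.
  exact: (@continuous_comp _ _ _ v (fun B : 'rV[R]_n => B ord0 k) t cv
    (@matrix_normedtype.coord_continuous _ _ _ _ _ _)).
have cAkj k j : {for t, continuous (fun s => A s k j)}.
  exact: (@continuous_comp _ _ _ A (fun B : 'M[R]_n => B k j) t cA
    (@matrix_normedtype.coord_continuous _ _ _ _ _ _)).
rewrite (_ : (fun s => _) = fun s =>
  \sum_j (\sum_k v s ord0 k * A s k j) * v s ord0 j); last first.
  by apply/funext => s; rewrite bilinE.
apply: continuous_sum => j; apply: continuousM => //.
by apply: continuous_sum => k; exact: continuousM.
Qed.

(** The constant is the minimum of the form on the compact unit sphere; homogeneity extends the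
    bound to all vectors. An empty sphere leaves only the zero vector. *)
Lemma posdef_bilin_ge A : (forall v, v != 0 -> 0 < bilin A v v) ->
  exists2 m : R, 0 < m & forall v, m * `|v| ^+ 2 <= bilin A v v.
Proof.
move=> A0; pose S := [set v : 'rV[R]_n | `|v| = 1].
have cS : compact S.
  apply: bounded_closed_compact.
    by exists 1; split => // M M1 v /= ->; exact: ltW.
  rewrite (_ : S = Num.norm @^-1` [set 1]).
    by apply: closed_comp => [v _|]; [exact: norm_continuous|exact: closed_eq].
  by apply/seteqP; split.
have [[v0 Sv0]|S0] := pselect (S !=set0); last first.
  exists 1 => // v; have [->|v0] := eqVneq v 0.
    by rewrite /bilin !mul0mx mxE normr0 expr0n mulr0.
  by exfalso; apply: S0; exists (`|v|^-1 *: v); rewrite /S/= normrZ normfV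
    normr_id mulVf// normr_eq0.
have cb : continuous (fun v => bilin A v v).
  move=> v; apply: (@continuous_bilin _ (fun=> A) id v);
    [exact: (@cst_continuous _ _ A v)|exact: cvg_id].
have [w /set_mem Sw wmin] := compact_EVT_min (ex_intro _ v0 Sv0) cS
  (continuous_subspaceT cb).
have w0 : w != 0 by apply/eqP => w0; move: Sw; rewrite /S/= w0 normr0 => /eqP;
  rewrite eq_sym oner_eq0.
exists (bilin A w w); first exact: A0.
move=> v; have [->|v_neq0] := eqVneq v 0.
  by rewrite normr0 expr0n mulr0 /bilin !mul0mx mxE.
rewrite -ler_pdivlMr ?exprn_gt0 ?normr_gt0// mulrC -exprVn -bilinZ.
by apply: wmin; rewrite inE /S/= normrZ normfV normr_id mulVf// normr_eq0.
Qed.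

(* Stated through [v |-> sqrt (bilin A v v)], the length of a tangent vector
   entering [speed]. *)
Lemma near_posdef_norm_equiv (A : 'M[R]_n) :
  (forall v, v != 0 -> 0 < bilin A v v) ->
  exists m k d : R, [/\ 0 < m, 0 < k, 0 < d & forall B, `|A - B| < d ->
    forall v, m * `|v| <= Num.sqrt (bilin B v v) <= k * `|v|].
Proof.
move=> /posdef_bilin_ge[c c0 cA].
have n20 : 0 < n%:R ^+ 2 + 1 :> R by rewrite ltr_wpDl// exprn_ge0.
(* By [ler_norm_bilin], a perturbation of [A] smaller than [d] consumes at most half of the lower
   bound [c]. *)
pose d := c / 2 / (n%:R ^+ 2 + 1).
have d0 : 0 < d by rewrite divr_gt0// divr_gt0.
pose K := n%:R ^+ 2 * (`|A| + d) + 1.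
have K0 : 0 < K by rewrite /K ltr_wpDl// mulr_ge0 ?exprn_ge0// addr_ge0// ltW.
exists (Num.sqrt (c / 2)), (Num.sqrt K), d.
split; rewrite ?sqrtr_gt0 ?divr_gt0// => B AB v.
have vE a : 0 <= a -> Num.sqrt a * `|v| = Num.sqrt (a * `|v| ^+ 2).
  by move=> a0; rewrite sqrtrM// sqrtr_sqr normr_id.
rewrite !vE ?divr_ge0 ?(ltW c0) ?(ltW K0)//.
have lo : c / 2 * `|v| ^+ 2 <= bilin B v v.
  have := cA v; have := ler_norm (bilin (A - B) v v).
  have := ler_norm_bilin (A - B) v v; rewrite -expr2 bilinBl => h1 h2 h3.
  suff : n%:R ^+ 2 * `|A - B| * `|v| ^+ 2 <= c / 2 * `|v| ^+ 2 by lra.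
  rewrite ler_wpM2r ?exprn_ge0//.
  apply: (@le_trans _ _ ((n%:R ^+ 2 + 1) * d)).
    by rewrite ler_pM ?exprn_ge0 ?lerDl// ltW.
  by rewrite /d mulrC divfK// gt_eqF.
have up : bilin B v v <= K * `|v| ^+ 2.
  rewrite (le_trans (ler_norm _))// (le_trans (ler_norm_bilin _ _ _))// -expr2.
  rewrite ler_wpM2r ?exprn_ge0// /K ler_wpDr// ler_wpM2l ?exprn_ge0//.
  have -> : B = A - (A - B) by rewrite opprB addrC subrK.
  by rewrite (le_trans (ler_normB _ _))// lerD2l ltW.
have b0 : 0 <= bilin B v v.
  by rewrite (le_trans _ lo)// mulr_ge0 ?exprn_ge0// divr_ge0// ltW.
have k0 : 0 <= K * `|v| ^+ 2 by rewrite mulr_ge0 ?exprn_ge0// ltW.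
by rewrite (ler_sqrt _ b0) (ler_sqrt _ k0) lo up.
Qed.

End bilin.


(** * The speed of a smooth curve in charts *)

Lemma C_class_subset (R : realType) (V W : normedModType R) k (O O' : set V)
    (f : V -> W) : O' `<=` O -> C_class k O f -> C_class k O' f.
Proof.
move=> sO; elim: k f => [|k ih] f [cf Df]; split => //=.
- by move=> x /sO; exact: cf.
- by move=> x /sO; exact: cf.
- move=> v; have [dv Cv] := Df v; split; last exact: ih.
  by move=> x /sO; exact: dv.
Qed.

Section curves.
Variables (R : realType) (n : nat) (M : topologicalType).
Variables (X : smooth_manifold R n M) (g : riemannian_metric X).
Implicit Types (c : R -> M) (a b t : R) (i j : chart X).

Definition tangent_norm i (q v : 'rV[R]_n) := Num.sqrt (bilin (tensor g i q) v v).

Lemma coord_continuous_at i x : dom i x -> {for x, continuous (coord i)}.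
Proof.
have := @coord_continuous _ _ _ X i; rewrite continuous_open_subspace.
  by move=> + ix; apply; rewrite inE.
exact: dom_open.
Qed.

Lemma smooth_curve_continuous a b c t : smooth_curve X a b c -> a < t < b ->
  {for t, continuous c}.
Proof.
move=> [cc _] abt; have : {within `]a, b[, continuous c}.
  by apply: continuous_subspaceW cc; exact: subset_itv_oo_cc.
by rewrite continuous_open_subspace//; apply; rewrite inE/= in_itv.
Qed.

(** [smooth_curve] only provides extensions relative to a closed interval and to a chart domain. At
    an interior time, continuity of [c] gives an open set of times on which the extension coincides
    with the curve, so that two-sided derivatives make sense. *)
Lemma smooth_curve_chart a b c t i : smooth_curve X a b c -> a < t < b ->
  dom i (c t) -> exists (O : set R) (F : R -> 'rV[R]_n),
  [/\ open O, O t, smooth O F &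
      forall s, O s -> [/\ a < s < b, dom i (c s) & coord i (c s) = F s]].
Proof.
move=> sc abt it; have ct := smooth_curve_continuous sc abt.
have [|O [F [oO Ot sF FE]]] := sc.2 i t; first by split => //=;
  move: abt => /andP[at_ tb]; rewrite in_itv/= !ltW.
pose D := [set s | a < s < b] `&` (c @^-1` dom i).
have Dt : D° t.
  rewrite /interior; apply: filterI.
    have : `]a, b[%classic t by rewrite /= in_itv.
    move=> /(conj (interval_open _ _)); have -> : [set s | a < s < b] = `]a, b[%classic.
      by apply/seteqP; split => s; rewrite /= in_itv.
    by move=> H; apply: open_nbhs_nbhs; apply: H.
  by apply: ct; apply: open_nbhs_nbhs; split => //; exact: dom_open.
exists (O `&` D°), F; split => //.
- by apply: openI => //; exact: open_interior.
- by move=> k; apply: C_class_subset (sF k) => s [].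
- move=> s [Os /interior_subset [abs is_]]; split => //.
  apply: FE => //; split => //=; move: abs => /andP[as_ sb].
  by rewrite in_itv/= !ltW.
Qed.

Lemma tensor_chart i x : dom i x -> exists (O : set 'rV[R]_n) (T : 'rV[R]_n -> 'M[R]_n),
  [/\ open O, O (coord i x), smooth O T &
    forall y, dom i y -> O (coord i y) -> tensor g i (coord i y) = T (coord i y)].
Proof. exact: (@tensor_smooth _ _ _ _ g i x). Qed.

(** [speed] uses an unspecified chart. The chain rule, applied to a local extension of the
    transition map, relates the two coordinate velocities exactly as [tensor_change] requires, so
    every chart gives the same value. *)
Lemma speedE a b c t i : smooth_curve X a b c -> a < t < b -> dom i (c t) ->
  speed g c t =
  tangent_norm i (coord i (c t)) ((coord i \o c)^`()%classic t).
Proof.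
move=> sc abt it; apply: xget_unique; first by exists i.
move=> _ [j jt ->]; rewrite /tangent_norm; congr Num.sqrt.
have [|O [F [oO Oq sF FE]]] := @transition_smooth _ _ _ X i j (c t); first by split.
have [P [G [oP Pt sG GE]]] := smooth_curve_chart sc abt it.
have [P1 [G1 [oP1 P1t sG1 GE1]]] := smooth_curve_chart sc abt jt.
have near_i : {near t, coord i \o c =1 G}.
  have : nbhs t P by exact: open_nbhs_nbhs.
  by apply: filterS => s /GE[_ _ /= ->].
have [_ _ GEt] := GE _ Pt.
have di : derivable (coord i \o c) t 1.
  have [_ /(_ 1)[dG _]] := sG 1%N.
  by apply: near_eq_derivable (dG _ Pt); apply: filterS near_i => s ->.
have cmp : is_derive t 1 (F \o (coord i \o c))
    ('D_('D_1 (coord i \o c) t) F (coord i (c t))).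
  exact: C1_derive_comp oO Oq (sF 1%N) di.
have dj : 'D_1 (coord j \o c) t = 'D_('D_1 (coord i \o c) t) F (coord i (c t)).
  rewrite -(@derive_val _ _ _ _ _ _ _ cmp); apply: near_eq_derive.
  near=> s.
  have [_ is_ _] : [/\ a < s < b, dom i (c s) & coord i (c s) = G s].
    by apply: GE; near: s; exact: open_nbhs_nbhs.
  have [_ js_ _] : [/\ a < s < b, dom j (c s) & coord j (c s) = G1 s].
    by apply: GE1; near: s; exact: open_nbhs_nbhs.
  rewrite /= FE//; near: s.
  apply: (continuous_comp (smooth_curve_continuous sc abt)
    (coord_continuous_at it)).
  exact: open_nbhs_nbhs.
rewrite !derive1E dj; apply/esym; apply: tensor_change oO Oq sF _ _ _ => //.
by move=> y iy jy Oy; exact: FE.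
Unshelve. all: by end_near. Qed.

Lemma speed_ge0 c t : 0 <= speed g c t.
Proof.
by rewrite /speed; case: xgetP => // _ _ [i _ ->]; exact: sqrtr_ge0.
Qed.

Lemma speed_continuous a b c t : smooth_curve X a b c -> a < t < b ->
  {for t, continuous (speed g c)}.
Proof.
move=> sc abt; have [i it] := dom_cover X (c t).
have [P [G [oP Pt sG GE]]] := smooth_curve_chart sc abt it.
have [Q [T [oQ Qt sT TE]]] := tensor_chart it.
have [_ _ GEt] := GE _ Pt.
pose h s := Num.sqrt (bilin (T (G s)) ('D_1 G s) ('D_1 G s)).
have hE : \forall s \near t, h s = speed g c s.
  near=> s.
  have Ps : P s by near: s; exact: open_nbhs_nbhs.
  have [abs is_ GEs] := GE _ Ps.
  have Qs : Q (coord i (c s)).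
    near: s; apply: (continuous_comp (smooth_curve_continuous sc abt)
      (coord_continuous_at it)).
    exact: open_nbhs_nbhs.
  have -> : speed g c s = tangent_norm i (coord i (c s)) ('D_1 G s).
    rewrite (speedE sc abs is_) derive1E; congr (tangent_norm _ _ _).
    apply: near_eq_derive; have : nbhs s P by exact: open_nbhs_nbhs.
    by apply: filterS => s' /GE[_ _ /= ->].
  by rewrite /h /tangent_norm (TE _ is_ Qs) GEs.
rewrite /prop_for /continuous_at -(nbhs_singleton hE).
have : h @ t --> h t.
  apply: (@continuous_comp _ _ _ (fun s => bilin (T (G s)) ('D_1 G s) ('D_1 G s))
    Num.sqrt); last exact: sqrt_continuous.
  apply: (@continuous_bilin _ _ _ (fun s => T (G s)) ('D_1 G)).
    apply: (@continuous_comp _ _ _ G T); first by have [+ _] := sG 0%N; apply.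
    by have [+ _] := sT 0%N; apply; rewrite -GEt.
  by have [_ /(_ 1)[_ [+ _]]] := sG 1%N; apply.
by apply: cvg_trans; apply: near_eq_cvg.
Unshelve. all: by end_near. Qed.

Lemma smooth_curve_measurable_speed a b c : smooth_curve X a b c ->
  measurable_fun `]a, b[ (speed g c).
Proof.
move=> sc; apply: measurable_realfun.open_continuous_measurable_fun.
  exact: interval_open.
by move=> t; rewrite inE/= in_itv; exact: speed_continuous sc.
Qed.

End curves.


(** * Piecewise smooth curves and their lengths *)

Section piecewise.
Variables (R : realType) (n : nat) (M : topologicalType).
Variables (X : smooth_manifold R n M) (g : riemannian_metric X).
Implicit Types (c : R -> M) (a b t : R) (i j : chart X).

(** A recursive form of [piecewise_smooth_curve] on arbitrary intervals; cutting and joining curves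
    then proceed by induction instead of by indexing a list of breakpoints. *)
Inductive piecewise_smooth_on c : R -> R -> Prop :=
| piecewise_smooth_nil a : piecewise_smooth_on c a a
| piecewise_smooth_cons a m b : a < m -> smooth_curve X a m c ->
    piecewise_smooth_on c m b -> piecewise_smooth_on c a b.

Lemma piecewise_smooth_curveP c :
  piecewise_smooth_curve X c <-> piecewise_smooth_on c 0 1.
Proof.
suff H a b : (exists s : seq R, [/\ path <%R a s, last a s = b &
    forall k, (k < size s)%N ->
      smooth_curve X (nth 0 (a :: s) k) (nth 0 (a :: s) k.+1) c]) <->
    piecewise_smooth_on c a b by exact: H.
split=> [[s]|].
  elim: s a => [|m s ih] a [/= + + sc]; first by move=> _ ->; constructor.
  move=> /andP[am ps] lb; apply: (@piecewise_smooth_cons _ _ m) => //.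
    exact: (sc 0%N).
  by apply: ih; split => // k ks; exact: (sc k.+1).
elim=> [{}a|{}a m {}b am sc _ [s [ps lb ss]]]; first by exists [::].
exists (m :: s); split => //=; first by rewrite am.
by case=> //= k; exact: ss.
Qed.

Lemma piecewise_smooth_le c a b : piecewise_smooth_on c a b -> a <= b.
Proof. by elim=> // {}a m {}b am _ _ mb; rewrite ltW// (lt_le_trans am). Qed.

Lemma piecewise_smooth_cat c a t b : piecewise_smooth_on c a t ->
  piecewise_smooth_on c t b -> piecewise_smooth_on c a b.
Proof.
elim=> // {}a m {}t am sc _ ih tb.
by apply: piecewise_smooth_cons am sc _; exact: ih.
Qed.

Lemma smooth_curve_eq a b c c' : (forall s, a <= s <= b -> c s = c' s) ->
  smooth_curve X a b c -> smooth_curve X a b c'.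
Proof.
move=> cc' [cc sc]; split.
  by apply: subspace_eq_continuous cc => s; rewrite inE/= in_itv/=; exact: cc'.
move=> i t [/= tab it]; have [|U [F [oU Ut sF FE]]] := sc i t.
  by split => //=; rewrite cc'//; move: tab; rewrite in_itv.
exists U, F; split => // s [/= sab is_] Us.
have sE : c s = c' s by apply: cc'; move: sab; rewrite in_itv.
by rewrite -sE -FE//=; split => //=; rewrite sE.
Qed.

Lemma smooth_curve_sub a b a' b' c : a <= a' -> b' <= b ->
  smooth_curve X a b c -> smooth_curve X a' b' c.
Proof.
move=> aa' bb' [cc sc].
have sub : `[a', b']%classic `<=` `[a, b]%classic.
  move=> s /=; rewrite !in_itv/= => /andP[as_ sb].
  by rewrite (le_trans aa')// (le_trans sb).
split; first exact: continuous_subspaceW cc.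
move=> i t [/= /sub tab it]; have [|U [F [oU Ut sF FE]]] := sc i t; first by split.
by exists U, F; split => // s [/= /sub sab is_] Us; exact: FE.
Qed.

Lemma piecewise_smooth_eq a b c c' : (forall s, a <= s <= b -> c s = c' s) ->
  piecewise_smooth_on c a b -> piecewise_smooth_on c' a b.
Proof.
move=> + pc; elim: pc => [{}a _|{}a m {}b am sc pc ih cc']; first by constructor.
have mb := piecewise_smooth_le pc.
apply: (piecewise_smooth_cons am).
  apply: smooth_curve_eq sc => s /andP[as_ sm]; apply: cc'.
  by rewrite as_ (le_trans sm).
by apply: ih => s /andP[ms sb]; apply: cc'; rewrite sb (le_trans (ltW am)).
Qed.

Lemma piecewise_smooth_split a b t c : piecewise_smooth_on c a b -> a <= t <= b ->
  piecewise_smooth_on c a t /\ piecewise_smooth_on c t b.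
Proof.
elim=> [{}a|{}a m {}b am sc pc ih].
  by rewrite -eq_le => /eqP <-; split; constructor.
move=> /andP[at_ tb]; have [tm|mt] := leP t m.
  split.
    have [->|a_neq] := eqVneq a t; first by constructor.
    apply: (@piecewise_smooth_cons _ _ t); last by constructor.
      by rewrite lt_neqAle a_neq.
    exact: smooth_curve_sub sc.
  have [->//|m_neq] := eqVneq t m.
  apply: piecewise_smooth_cons pc; first by rewrite lt_neqAle m_neq.
  exact: smooth_curve_sub sc.
have [|p1 p2] := ih; first by rewrite ltW.
by split => //; exact: piecewise_smooth_cons am sc p1.
Qed.

Lemma piecewise_smooth_continuous a b c : piecewise_smooth_on c a b ->
  {within `[a, b], continuous c}.
Proof.
elim=> [{}a|{}a m {}b am [cc _] pc mpc].
  by rewrite set_itv1; exact: continuous_subspace1.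
have mb := piecewise_smooth_le pc.
have -> : `[a, b]%classic = `[a, m]%classic `|` `[m, b]%classic.
  apply/seteqP; split => s /=; rewrite !in_itv/=.
    move=> /andP[as_ sb]; have [sm|/ltW ms] := leP s m.
      by left; rewrite as_.
    by right; rewrite ms sb.
  move=> [/andP[-> sm]|/andP[ms ->]]; first by rewrite (le_trans sm).
  by rewrite (le_trans (ltW am)).
by apply: withinU_continuous => //; exact: interval_closed.
Qed.

Definition length_on c a b :=
  (\int[@lebesgue_measure R]_(t in `[a, b]) (speed g c t)%:E)%E.

(** Continuity of the speed is available only inside each smooth piece. The breakpoints, where its
    value is arbitrary, are split off as singletons. *)
Lemma measurable_speed a b c : piecewise_smooth_on c a b ->
  measurable_fun `[a, b] (speed g c).
Proof.
elim=> [{}a|{}a m {}b am sc pc mpc].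
  by rewrite set_itv1; exact: measurable_fun_set1.
have mb := piecewise_smooth_le pc.
have -> : `[a, b]%classic = ([set a] `|` `]a, m[%classic) `|` `[m, b]%classic.
  apply/seteqP; split => s /=; rewrite !in_itv/=.
    move=> /andP[as_ ->]; have [ms|sm] := leP m s; first by right.
    by left; move: as_; rewrite le_eqVlt => /predU1P[->|->]; [left|right].
  move=> [[->|/andP[as_ sm]]|/andP[ms ->]].
  - by rewrite lexx (le_trans (ltW am)).
  - by rewrite (ltW as_) (le_trans (ltW sm)).
  - by rewrite (le_trans (ltW am)).
apply/measurable_funU => //; first exact: measurableU.
split => //; apply/measurable_funU => //; split.
  exact: measurable_fun_set1.
exact: smooth_curve_measurable_speed sc.
Qed.

Lemma measurable_speedE a b c : piecewise_smooth_on c a b ->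
  measurable_fun `[a, b] (EFin \o speed g c).
Proof. by move=> pc; apply/measurable_EFinP; exact: measurable_speed. Qed.

Lemma length_on_ge0 c a b : (0 <= length_on c a b)%E.
Proof. by apply: integral_ge0 => t _; rewrite lee_fin speed_ge0. Qed.

Lemma length_on_oo c a b : piecewise_smooth_on c a b ->
  length_on c a b = (\int[@lebesgue_measure R]_(t in `]a, b[) (speed g c t)%:E)%E.
Proof.
move=> pc; have mc := measurable_speedE pc.
have m1 : measurable_fun `[a, b[ (EFin \o speed g c).
  by apply: measurable_funS mc => //; exact: subset_itv_co_cc.
rewrite /length_on -integral_itv_bndo_bndc// -integral_itv_obnd_cbnd//.
by apply: measurable_funS m1 => //; exact: subset_itv_oo_co.
Qed.

Lemma length_on_cat c a t b : piecewise_smooth_on c a t ->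
  piecewise_smooth_on c t b ->
  length_on c a b = (length_on c a t + length_on c t b)%E.
Proof.
move=> pa pb; have mc := measurable_speedE (piecewise_smooth_cat pa pb).
have at_ := piecewise_smooth_le pa; have tb := piecewise_smooth_le pb.
have abE : `[a, b]%classic = `[a, t[%classic `|` `[t, b]%classic.
  apply/seteqP; split => s /=; rewrite !in_itv/=.
    move=> /andP[as_ sb]; have [ts|st] := leP t s; first by right.
    by left; rewrite as_.
  move=> [/andP[-> st]|/andP[ts ->]]; first by rewrite (le_trans (ltW st)).
  by rewrite (le_trans at_).
rewrite /length_on [in LHS]abE ge0_integral_setU//.
- congr (_ + _)%E; apply: integral_itv_bndo_bndc.
  apply: measurable_funS (measurable_speedE pa) => //.
  exact: subset_itv_co_cc.
- by rewrite -abE.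
- by move=> s _; rewrite lee_fin speed_ge0.
- rewrite disj_set2E; apply/eqP/seteqP; split => // s [] /=; rewrite !in_itv/=.
  by move=> /andP[_ st] /andP[ts _]; have := lt_le_trans st ts; rewrite ltxx.
Qed.

(** The speed at an interior time depends only on the curve near that time, and the endpoints do not
    contribute to the integral. *)
Lemma length_on_eq c c' a b : piecewise_smooth_on c a b ->
  piecewise_smooth_on c' a b -> (forall s, a < s < b -> c s = c' s) ->
  length_on c a b = length_on c' a b.
Proof.
move=> pc pc' cc'; rewrite (length_on_oo pc) (length_on_oo pc'); apply: eq_integral => t.
rewrite inE/= in_itv/= => abt; have ctE := cc' t abt.
have H i : (coord i \o c)^`()%classic t = (coord i \o c')^`()%classic t.
  rewrite derive1E.
  rewrite [RHS]derive1E.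
  apply: (@near_eq_derive R R 'rV[R]_n).
  near=> s.
  have : `]a, b[%classic s.
    near: s; apply: open_nbhs_nbhs; split; first exact: interval_open.
    by rewrite /= in_itv.
  by rewrite /= in_itv => abs; rewrite (cc' s abs).
rewrite /speed -ctE; apply: (congr1 (fun S => (xget 0 S)%:E)).
apply/seteqP; split => r [i it ->]; (exists i; first exact: it).
  by rewrite (H i).
by rewrite -(H i).
Unshelve. all: by end_near. Qed.

End piecewise.


(** * Lengths compared with coordinate distances *)

Section length_bounds.
Variables (R : realType) (n : nat) (M : topologicalType).
Variables (X : smooth_manifold R n M) (g : riemannian_metric X).
Implicit Types (c : R -> M) (a b t : R) (i j : chart X).

Lemma curve_chart_C1 a b c s i : smooth_curve X a b c -> a < s < b ->
  dom i (c s) -> derivable (coord i \o c) s 1 /\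
  {for s, continuous ((coord i \o c)^`()%classic)}.
Proof.
move=> sc abs is_; have [P [G [oP Ps sG GE]]] := smooth_curve_chart sc abs is_.
have near_s t : P t -> \forall u \near t, G u = (coord i \o c) u.
  move=> Pt; have : nbhs t P by exact: open_nbhs_nbhs.
  by apply: filterS => u /GE[_ _ /= ->].
have [_ /(_ 1)[dG [cG _]]] := sG 1%N.
split; first by apply: near_eq_derivable (dG _ Ps); exact: near_s.
have dE t : P t -> (coord i \o c)^`()%classic t = 'D_1 G t.
  by move=> Pt; rewrite derive1E; apply/esym; apply: near_eq_derive; exact: near_s.
rewrite /prop_for /continuous_at (dE _ Ps).
apply: cvg_trans (cG _ Ps); apply: near_eq_cvg.
have : nbhs s P by exact: open_nbhs_nbhs.
by apply: filterS => t Pt; rewrite dE.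
Qed.

(** The norm is the maximum of the entries, so the fundamental theorem of calculus is applied to one
    coordinate at a time. The subinterval lies strictly inside [[a, b]], where the two-sided
    derivative of the curve exists and is continuous. *)
Lemma smooth_length_ge_inner a b a' b' c i m : smooth_curve X a b c ->
  a < a' -> a' < b' -> b' < b -> 0 < m ->
  (forall s, a < s < b -> dom i (c s)) ->
  (forall s v, a < s < b -> m * `|v| <= tangent_norm g i (coord i (c s)) v) ->
  ((m * `|coord i (c b') - coord i (c a')|)%:E <= length_on g c a b)%E.
Proof.
move=> sc aa' ab' b'b m_gt0 ic mc; have m0 := ltW m_gt0.
have inab s : a' <= s <= b' -> a < s < b.
  by move=> /andP[a's sb']; rewrite (lt_le_trans aa')//= (le_lt_trans sb').
have inab' s : `[a', b']%classic s -> a < s < b by rewrite /= in_itv => /inab.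
pose y := coord i \o c.
have C1 s : a' <= s <= b' -> derivable y s 1 /\ {for s, continuous (y^`()%classic)}.
  by move=> /inab abs; exact: (curve_chart_C1 sc abs (ic s abs)).
have mspeed : measurable_fun `[a', b'] (EFin \o speed g c).
  apply/measurable_EFinP.
  by apply: measurable_funS (smooth_curve_measurable_speed g sc) => //.
have Lge : (\int[@lebesgue_measure R]_(s in `[a', b']) (speed g c s)%:E <=
            length_on g c a b)%E.
  have pc : piecewise_smooth_on X c a b.
    apply: piecewise_smooth_cons sc (piecewise_smooth_nil _ _ _).
    by rewrite (lt_trans aa')// (lt_trans ab').
  apply: ge0_subset_integral => //; first exact: measurable_speedE.
    by move=> s _; rewrite lee_fin speed_ge0.
  move=> s /inab' /andP[as_ sb]; rewrite /= in_itv/= !ltW//.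
apply: le_trans Lge.
have entry k : ((m * `|y b' ord0 k - y a' ord0 k|)%:E <=
    \int[@lebesgue_measure R]_(s in `[a', b']) (speed g c s)%:E)%E.
  pose f s := y^`()%classic s ord0 k.
  have cf : {within `[a', b'], continuous f}.
    apply: continuous_in_subspaceT => s; rewrite inE/= in_itv => /C1[_ cy].
    exact: (@continuous_comp _ _ _ (y^`()%classic) (fun A : 'rV[R]_n => A ord0 k) s
      cy (@matrix_normedtype.coord_continuous _ _ _ _ _ _)).
  have cF s : a' <= s <= b' -> {for s, continuous (fun s => y s ord0 k)}.
    move=> /C1[/derivable_mxP /(_ ord0 k) dy _].
    exact/differentiable_continuous/derivable1_diffP.
  have ftc : (\int[@lebesgue_measure R]_(s in `[a', b']) (f s)%:E =
      (y b' ord0 k)%:E - (y a' ord0 k)%:E)%E.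
    apply: (@continuous_FTC2 _ f (fun s => y s ord0 k)) => //.
      split.
      - move=> s; rewrite in_itv/= => /andP[/ltW a's /ltW sb'].
        by have [|/derivable_mxP dy _] := C1 s; [rewrite a's|exact: dy].
      - by apply: cvg_at_right_filter; apply: cF; rewrite lexx ltW.
      - by apply: cvg_at_left_filter; apply: cF; rewrite lexx ltW.
    move=> s; rewrite in_itv/= => /andP[/ltW a's /ltW sb'].
    have [|dy _] := C1 s; first by rewrite a's.
    by rewrite /f !derive1E [in RHS]derive_mx// mxE.
  have mf : measurable_fun `[a', b'] f.
    exact: subspace_continuous_measurable_fun.
  have mEf : measurable_fun `[a', b'] (EFin \o f) by exact/measurable_EFinP.
  rewrite EFinM -[(`|_|)%:E]/(`|(y b' ord0 k - y a' ord0 k)%:E|)%E EFinB -ftc.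
  apply: (@le_trans _ _ (m%:E * \int[@lebesgue_measure R]_(s in `[a', b']) `|(f s)%:E|)%E).
    by rewrite lee_wpmul2l// le_abse_integral.
  rewrite -ge0_integralZl_EFin//; last exact: measurableT_comp.
  apply: ge0_le_integral => //.
  - by move=> s _; rewrite mule_ge0.
  - by apply: measurable_funeM; exact: measurableT_comp.
  move=> s /inab' abs; rewrite -EFinM lee_fin (speedE g sc abs (ic _ abs)).
  rewrite (le_trans _ (mc _ _ abs))// ler_wpM2l//.
  exact: ler_mx_norm_entry.
have : (0 <= \int[@lebesgue_measure R]_(s in `[a', b']) (speed g c s)%:E)%E.
  by apply: integral_ge0 => s _; rewrite lee_fin speed_ge0.
move: entry; case: (integral _ _ _) => [r| |] entry; rewrite ?leey// lee_fin => r0.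
rewrite lee_fin mulrC -ler_pdivlMr//; apply: mx_norm_leP => [|p k].
  by rewrite divr_ge0.
by rewrite (ord1 p) !mxE ler_pdivlMr// mulrC -lee_fin; exact: entry.
Qed.

Lemma coord_curve_continuous a b c i : {within `[a, b], continuous c} ->
  (forall s, a <= s <= b -> dom i (c s)) ->
  {within `[a, b], continuous (coord i \o c)}.
Proof.
move=> /subspace_continuousP cc ic; apply/subspace_continuousP => s sab.
apply: cvg_comp (cc s sab) _; apply: coord_continuous_at.
by apply: ic; move: sab; rewrite /= in_itv.
Qed.

(** Limit of [smooth_length_ge_inner] as the inner endpoints tend to [a] and [b], by continuity of
    the curve. *)
Lemma smooth_length_ge a b c i m : a < b -> smooth_curve X a b c -> 0 < m ->
  (forall s, a <= s <= b -> dom i (c s)) ->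
  (forall s v, a <= s <= b -> m * `|v| <= tangent_norm g i (coord i (c s)) v) ->
  ((m * `|coord i (c b) - coord i (c a)|)%:E <= length_on g c a b)%E.
Proof.
move=> ab sc m0 ic mc; apply/lee_addgt0Pr => e e0.
have [_ ya yb] := (continuous_within_itvP _ ab).1 (coord_curve_continuous sc.1 ic).
(* Each of the two endpoints is allowed an error [m * d = e / 2]. *)
pose d := e / 2 / m; have d0 : 0 < d by rewrite !divr_gt0.
have mid : a < (a + b) / 2 < b by lra.
have [a' [/= aa' a'm ya']] : exists a', [/\ a < a', a' < (a + b) / 2 &
    `|coord i (c a) - coord i (c a')| <= d].
  apply: (@filter_ex _ (a^'+)); near=> s; split.
  - by near: s; exact: nbhs_right_gt.
  - by near: s; apply: nbhs_right_lt; case/andP: mid.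
  - by near: s; move/cvgrPdist_le : ya; exact.
have [b' [/= mb' b'b yb']] : exists b', [/\ (a + b) / 2 < b', b' < b &
    `|coord i (c b) - coord i (c b')| <= d].
  apply: (@filter_ex _ (b^'-)); near=> s; split.
  - by near: s; apply: nbhs_left_gt; case/andP: mid.
  - by near: s; exact: nbhs_left_lt.
  - by near: s; move/cvgrPdist_le : yb; exact.
have W s : a < s < b -> a <= s <= b by move=> /andP[as_ sb]; rewrite !ltW.
have inner := @smooth_length_ge_inner a b a' b' c i m sc aa' (lt_trans a'm mb')
  b'b m0 (fun s abs => ic s (W s abs)) (fun s v abs => mc s v (W s abs)).
apply: le_trans (leeD2r _ inner); rewrite -EFinD lee_fin.
have -> : e = m * (d + d) by rewrite /d; field; rewrite gt_eqF.
rewrite -mulrDr ler_wpM2l ?(ltW m0)//.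
have -> : coord i (c b) - coord i (c a) = (coord i (c b') - coord i (c a')) +
    ((coord i (c b) - coord i (c b')) - (coord i (c a) - coord i (c a'))).
  by rewrite opprB addrA [X in _ = X + _]addrC !subrKA.
rewrite (le_trans (ler_normD _ _))// lerD2l (le_trans (ler_normB _ _))//.
exact: lerD.
Unshelve. all: by end_near. Qed.

Lemma length_on_ge a b c i m : piecewise_smooth_on X c a b -> 0 < m ->
  (forall s, a <= s <= b -> dom i (c s)) ->
  (forall s v, a <= s <= b -> m * `|v| <= tangent_norm g i (coord i (c s)) v) ->
  ((m * `|coord i (c b) - coord i (c a)|)%:E <= length_on g c a b)%E.
Proof.
elim=> [{}a|{}a t {}b at_ sc pc ih] m0 ic mc.
  by rewrite subrr normr0 mulr0 length_on_ge0.
have tb := piecewise_smooth_le pc.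
have W1 s : a <= s <= t -> a <= s <= b.
  by move=> /andP[-> st]; rewrite (le_trans st).
have W2 s : t <= s <= b -> a <= s <= b.
  by move=> /andP[ts ->]; rewrite (le_trans (ltW at_)).
have p1 : piecewise_smooth_on X c a t.
  exact: piecewise_smooth_cons at_ sc (piecewise_smooth_nil _ _ _).
rewrite (length_on_cat g p1 pc).
apply: le_trans (leeD (smooth_length_ge at_ sc m0 (fun s h => ic s (W1 s h))
    (fun s v h => mc s v (W1 s h)))
  (ih m0 (fun s h => ic s (W2 s h)) (fun s v h => mc s v (W2 s h)))).
rewrite -EFinD lee_fin -mulrDr ler_wpM2l ?(ltW m0)// [leRHS]addrC.
by rewrite (le_trans _ (ler_normD _ _))// subrKA.
Qed.

Lemma line_length_le a b c i (u p : 'rV[R]_n) k : a <= b ->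
  smooth_curve X a b c -> 0 <= k ->
  (forall s, a < s < b -> dom i (c s) /\ coord i (c s) = s *: u + p) ->
  (forall s v, a < s < b -> tangent_norm g i (coord i (c s)) v <= k * `|v|) ->
  (length_on g c a b <= (k * `|u| * (b - a))%:E)%E.
Proof.
rewrite le_eqVlt => /predU1P[<- *|ab sc k0 ic kc].
  by rewrite /length_on set_itv1 integral_set1 subrr mulr0.
have pc := piecewise_smooth_cons ab sc (piecewise_smooth_nil _ _ _).
rewrite (length_on_oo g pc).
apply: (@le_trans _ _ (\int[@lebesgue_measure R]_(t in `]a, b[) (k * `|u|)%:E)%E).
  apply: ge0_le_integral => //.
  - by move=> s _; rewrite lee_fin speed_ge0.
  - apply/measurable_EFinP; exact: (smooth_curve_measurable_speed g sc).
  - move=> s; rewrite /= in_itv/= => abs; rewrite lee_fin.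
    have [is_ _] := ic s abs; rewrite (speedE g sc abs is_).
    suff -> : (coord i \o c)^`()%classic s = u by exact: kc.
    have := derive_line id p u s 1; rewrite /= derive_id scale1r => <-.
    rewrite derive1E; apply: near_eq_derive; near=> t.
    suff /ic[_] : a < t < b by [].
    suff : `]a, b[%classic t by rewrite /= in_itv.
    near: t; apply: open_nbhs_nbhs; split; first exact: interval_open.
    by rewrite /= in_itv.
apply: (@le_trans _ _ ((k * `|u|)%:E * @lebesgue_measure R `]a, b[%classic)%E).
  by rewrite le_eqVlt; apply/orP; left; apply/eqP; exact: integral_cst.
by rewrite lebesgue_measure_itv/= lte_fin ab.
Unshelve. all: by end_near. Qed.

End length_bounds.


(** * Coordinate balls and straight segments *)

Section chart_balls.
Variables (R : realType) (n : nat) (M : topologicalType).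
Variables (X : smooth_manifold R n M) (g : riemannian_metric X).
Implicit Types (c : R -> M) (a b t m k d : R) (i j : chart X) (p q r : 'rV[R]_n).

Lemma coord_half_space i x : dom i x -> half_space (coord i x).
Proof.
move=> ix; have [U _ UE] := @coord_open _ _ _ X i _ (dom_open i) (@subset_refl _ _).
have : (coord i @` dom i) (coord i x) by exists x.
by rewrite UE => -[].
Qed.

(** The inverse of a chart is continuous, because [coord i] maps open subsets of its domain to
    relatively open subsets of the half-space. *)
Lemma continuous_coord_reflect (T : topologicalType) (A : set T) (f : T -> M) i :
  (forall s, A s -> dom i (f s)) -> {within A, continuous (coord i \o f)} ->
  {within A, continuous f}.
Proof.
move=> fi /subspace_continuousP cf; apply/subspace_continuousP => s As V Vfs.
have [U oU UE] := @coord_open _ _ _ X i (V° `&` dom i)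
  (openI (@open_interior _ V) (dom_open i)) (@subIsetr _ _ _).
have Us : U (coord i (f s)).
  have : (coord i @` (V° `&` dom i)) (coord i (f s)).
    by exists (f s) => //; split => //; exact: fi.
  by rewrite UE => -[].
have Uf : nbhs s [set t | A t -> U (coord i (f t))].
  by apply: (cf s As); exact: open_nbhs_nbhs.
change (nbhs s [set t | A t -> V (f t)]).
apply: filterS Uf => t /= Ut /[dup] At /Ut {}Ut.
have : (U `&` @half_space R n) (coord i (f t)).
  by split; [exact: Ut|apply: coord_half_space; exact: fi].
rewrite -UE => -[z [Vz iz] zt].
have zE : z = f t by apply: (@coord_inj _ _ _ X i); rewrite ?inE//; exact: fi.
by rewrite -zE; exact: interior_subset.
Qed.

Lemma half_space_convex q r (s : R) : half_space q -> half_space r -> 0 <= s <= 1 ->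
  half_space ((1 - s) *: q + s *: r).
Proof.
move=> hq hr /andP[s0 s1] k k0; rewrite !mxE addr_ge0// mulr_ge0//.
- by rewrite subr_ge0.
- exact: hq.
- exact: hr.
Qed.

(** The local data for all length estimates: the chart fills the half-ball of radius [d] about [p],
    and there the tangent norm is comparable to the coordinate norm with fixed constants. The center
    is a coordinate vector, so that it can be moved by [chart_ball_sub] without changing [m] and
    [k]. *)
Record chart_ball i p m k d : Prop := ChartBall {
  chart_ball_m : 0 < m ;
  chart_ball_k : 0 < k ;
  chart_ball_d : 0 < d ;
  chart_ball_onto : forall q, half_space q -> `|p - q| < d ->
    exists2 y, dom i y & coord i y = q ;
  chart_ball_norm : forall y v, dom i y -> `|p - coord i y| < d ->
    m * `|v| <= tangent_norm g i (coord i y) v <= k * `|v| }.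

Lemma chart_ball_sub i p m k d q d' : chart_ball i p m k d -> 0 < d' ->
  `|p - q| + d' <= d -> chart_ball i q m k d'.
Proof.
move=> [m0 k0 d0 onto nrm] d'0 pqd.
have W r : `|q - r| < d' -> `|p - r| < d.
  move=> qr; rewrite -(subrKA q) (le_lt_trans (ler_normD _ _))//.
  by rewrite (lt_le_trans _ pqd)// ltrD2l.
split => //; first by move=> r hr /W; exact: onto.
by move=> y v iy /W; exact: nrm.
Qed.

Lemma exists_chart_ball i x : dom i x -> exists m k d, chart_ball i (coord i x) m k d.
Proof.
move=> ix; have [Q [T [oQ Qx sT TE]]] := tensor_chart g ix.
have [m [k [d1 [m0 k0 d10 nrm]]]] := near_posdef_norm_equiv
  (fun v v0 => @tensor_pos _ _ _ _ g i x v ix v0).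
have [U oU UE] := @coord_open _ _ _ X i _ (dom_open i) (@subset_refl _ _).
have Ux : U (coord i x).
  have : (coord i @` dom i) (coord i x) by exists x.
  by rewrite UE => -[].
have /nbhs_ballP[d2 /= d20 d2U] : nbhs (coord i x) U by exact: open_nbhs_nbhs.
have /nbhs_ballP[d3 /= d30 d3Q] : nbhs (coord i x) Q by exact: open_nbhs_nbhs.
have [cT _] := sT 0%N; have {}cT := cT _ Qx.
have /nbhs_ballP[d4 /= d40 d4T] : nbhs (coord i x)
    (T @^-1` ball (T (coord i x)) d1) by apply: cT; exact: nbhsx_ballx.
(* [d2] keeps the half-ball in the image of the chart, [d3] keeps it where the extension [T]
   represents the tensor, and [d4] keeps [T] within [d1] of its value at the center. *)
exists m, k, (Num.min d2 (Num.min d3 d4)); split; rewrite ?lt_min ?d20 ?d30//.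
  move=> q hq; rewrite !lt_min => /and3P[q2 q3 q4].
  have : (U `&` @half_space R n) q by split => //; apply: d2U; rewrite -ball_normE.
  by rewrite -UE => -[y iy yq]; exists y.
move=> y v iy; rewrite !lt_min => /and3P[q2 q3 q4].
have Qy : Q (coord i y) by apply: d3Q; rewrite -ball_normE.
apply: nrm; rewrite (TE _ iy Qy) (TE _ ix Qx).
have := d4T (coord i y); rewrite -!ball_normE /ball_ /=; exact.
Qed.

(** The half-ball is convex, so the affine segment from [q] to [r] stays in the image of the chart
    and lifts to M. In any other chart the lift is a transition map composed with an affine map,
    hence smooth. *)
Lemma segment_curve i p m k d a b q r : chart_ball i p m k d -> a < b ->
  half_space q -> `|p - q| < d -> half_space r -> `|p - r| < d ->
  exists c, [/\ piecewise_smooth_on X c a b,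
    dom i (c a) /\ coord i (c a) = q,
    dom i (c b) /\ coord i (c b) = r &
    (length_on g c a b <= (k * `|r - q|)%:E)%E].
Proof.
move=> [m0 k0 d0 onto nrm] ab hq pq hr pr.
have ba0 : 0 < b - a by rewrite subr_gt0.
pose u := (b - a)^-1 *: (r - q); pose p0 := q - a *: u.
pose l s := s *: u + p0.
have lE s : l s = (1 - (s - a) / (b - a)) *: q + ((s - a) / (b - a)) *: r.
  rewrite /l /p0 /u !scalerBr !scalerA scalerBl scale1r mulrBl scalerBl.
  apply/rowP => z; rewrite !mxE; ring.
have lab s : a <= s <= b -> half_space (l s) /\ `|p - l s| < d.
  move=> /andP[as_ sb].
  have th : 0 <= (s - a) / (b - a) <= 1.
    rewrite divr_ge0 ?subr_ge0 ?(ltW ab)//= ler_pdivrMr// mul1r.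
    by rewrite lerD2r.
  rewrite lE; split; first exact: half_space_convex.
  move: ((s - a) / (b - a)) th => th_ /andP[th0 th1].
  have -> : p - ((1 - th_) *: q + th_ *: r) =
      (1 - th_) *: (p - q) + th_ *: (p - r).
    by apply/rowP => z; rewrite !mxE; ring.
  rewrite (le_lt_trans (ler_normD _ _))// !normrZ !ger0_norm// ?subr_ge0//.
  have [->|th_neq0] := eqVneq th_ 0; first by rewrite mul0r addr0 subr0 mul1r.
  have th_gt0 : 0 < th_ by rewrite lt_neqAle eq_sym th_neq0.
  apply: (@lt_le_trans _ _ ((1 - th_) * d + th_ * d)); last first.
    by rewrite -mulrDl subrK mul1r.
  by rewrite ler_ltD// ?ltr_pM2l// ler_wpM2l ?subr_ge0// ltW.
have [x0 _ _] := onto _ hq pq.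
(* By [onto] the set is nonempty for [s] in [[a, b]], so the default [x0] matters only outside of
   this interval. *)
pose c s := xget x0 [set x | dom i x /\ coord i x = l s].
have cP s : a <= s <= b -> dom i (c s) /\ coord i (c s) = l s.
  move=> /lab[hl pl]; have [y iy ys] := onto _ hl pl.
  exact: (@xgetI _ x0 [set x | dom i x /\ coord i x = l s] y).
have cl : continuous l by exact: continuous_line.
have sc : smooth_curve X a b c.
  split.
    apply: (@continuous_coord_reflect _ _ c i).
      by move=> s; rewrite /= in_itv => /cP[].
    apply: (@subspace_eq_continuous _ `[a, b]%classic _ l).
      by move=> s; rewrite inE/= in_itv => /cP[_ csE]; exact: esym csE.
    exact: continuous_subspaceT.
  move=> j s [/= sab js]; have {}sab : a <= s <= b by move: sab; rewrite /= in_itv.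
  have [ics cs] := cP s sab.
  have [|U [F [oU Ucs sF FE]]] := @transition_smooth _ _ _ X i j (c s); first by split.
  exists (l @^-1` U), (F \o l); split.
  - by apply: open_comp => // t _; exact: cl.
  - by rewrite /= -cs.
  - exact: smooth_line.
  - move=> t [/= tab jt] Ult; have {}tab : a <= t <= b by move: tab; rewrite /= in_itv.
    by have [ict ct] := cP t tab; rewrite FE ?ct//; split.
exists c; split.
- exact: piecewise_smooth_cons ab sc (piecewise_smooth_nil _ _ _).
- have [|? ->] := cP a; first by rewrite lexx ltW.
  by split => //; rewrite /l /p0 addrC subrK.
- have [|? ->] := cP b; first by rewrite lexx ltW.
  split => //; rewrite lE divff ?gt_eqF// subrr scale0r add0r.
  by rewrite scale1r.
have W s : a < s < b -> a <= s <= b by move=> /andP[as_ sb]; rewrite !ltW.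
apply: le_trans (line_length_le (ltW ab) sc (ltW k0) _ _) _.
- by move=> s /W /cP; exact.
- move=> s v /W sab; have [ics cs] := cP s sab; have [_ pl] := lab s sab.
  by have := @nrm (c s) v ics; rewrite cs => /(_ pl)/andP[].
rewrite lee_fin /u normrZ gtr0_norm ?invr_gt0// mulrAC -!mulrA.
by rewrite ler_wpM2l ?(ltW k0)// mulrA mulfV ?gt_eqF// mul1r.
Qed.

End chart_balls.


(** * Local Lipschitz bounds for the distance *)

Section distance.
Variables (R : realType) (n : nat) (M : topologicalType).
Variables (X : smooth_manifold R n M) (g : riemannian_metric X).
Implicit Types (c : R -> M) (a b t m k d : R) (i j : chart X) (p q r : 'rV[R]_n).

Lemma dist_le_length c : piecewise_smooth_on X c 0 1 ->
  (riemannian_dist g (c 0%R) (c 1%R) <= length_on g c 0 1)%E.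
Proof.
move=> pc; apply: ereal_inf_lbound; exists c => //.
by split => //; exact/piecewise_smooth_curveP.
Qed.

Lemma length_lt_of_dist_lt x y e : (riemannian_dist g x y < e)%E -> exists c,
  [/\ piecewise_smooth_on X c 0 1, c 0%R = x, c 1%R = y & (length_on g c 0 1 < e)%E].
Proof.
move=> /ereal_inf_lt[_ [c [/piecewise_smooth_curveP pc c0 c1] <-] ce].
by exists c.
Qed.

Lemma join_curves c1 c2 a t b : piecewise_smooth_on X c1 a t ->
  piecewise_smooth_on X c2 t b -> c1 t = c2 t -> exists c,
  [/\ piecewise_smooth_on X c a b, c a = c1 a, c b = c2 b &
    length_on g c a b = (length_on g c1 a t + length_on g c2 t b)%E].
Proof.
move=> p1 p2 ct; have at_ := piecewise_smooth_le p1; have tb := piecewise_smooth_le p2.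
pose c s := if s <= t then c1 s else c2 s.
have e1 s : s <= t -> c1 s = c s by rewrite /c => ->.
have e2 s : t <= s -> c2 s = c s.
  by rewrite le_eqVlt /c => /predU1P[<-|ts]; [rewrite lexx ct|rewrite leNgt ts].
have q1 : piecewise_smooth_on X c a t.
  by apply: piecewise_smooth_eq p1 => s /andP[_]; exact: e1.
have q2 : piecewise_smooth_on X c t b.
  by apply: piecewise_smooth_eq p2 => s /andP[ts _]; exact: e2.
exists c; split.
- exact: piecewise_smooth_cat q1 q2.
- by rewrite e1.
- by rewrite e2.
have E1 : length_on g c1 a t = length_on g c a t.
  by apply: (length_on_eq g p1 q1) => s /andP[_ /ltW]; exact: e1.
have E2 : length_on g c2 t b = length_on g c t b.
  by apply: (length_on_eq g p2 q2) => s /andP[/ltW ts _]; exact: e2.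
by rewrite (length_on_cat g q1 q2) E1 E2.
Qed.

(** On [[0, t]] the curve is replaced by the segment from [x] to [c t], run over the same time
    interval. Thus no reparametrization occurs, and [0 < t] provides the time for the segment. *)
Lemma dist_replace_start i p m k d c t x : chart_ball g i p m k d ->
  piecewise_smooth_on X c 0 1 -> 0 < t <= 1 ->
  dom i (c t) -> `|p - coord i (c t)| < d ->
  dom i x -> `|p - coord i x| < d ->
  (riemannian_dist g x (c 1%R) <=
    (k * `|coord i (c t) - coord i x|)%:E + length_on g c t 1)%E.
Proof.
move=> cb pc /andP[t0 t1] ict pct ix px.
have [c1 [p1 [ic0 c10] [ict' c1t] L1]] := segment_curve cb t0
  (coord_half_space ix) px (coord_half_space ict) pct.
have [|_ p2] := piecewise_smooth_split pc (t := t); first by rewrite (ltW t0).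
have [|c' [p' c'0 c'1 L]] := join_curves p1 p2.
  by apply: (@coord_inj _ _ _ X i); rewrite ?inE.
have c'x : c' 0 = x.
  by rewrite c'0; apply: (@coord_inj _ _ _ X i); rewrite ?inE.
rewrite -[X in riemannian_dist g X]c'x -c'1 (le_trans (dist_le_length p'))// L.
exact: leeD2r.
Qed.

Lemma dist_replace_end i p m k d c t y : chart_ball g i p m k d ->
  piecewise_smooth_on X c 0 1 -> 0 <= t < 1 ->
  dom i (c t) -> `|p - coord i (c t)| < d ->
  dom i y -> `|p - coord i y| < d ->
  (riemannian_dist g (c 0%R) y <=
    length_on g c 0 t + (k * `|coord i y - coord i (c t)|)%:E)%E.
Proof.
move=> cb pc /andP[t0 t1] ict pct iy py.
have [c1 [p1 [ict' c1t] [ic1 c11] L1]] := segment_curve cb t1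
  (coord_half_space ict) pct (coord_half_space iy) py.
have [|p2 _] := piecewise_smooth_split pc (t := t); first by rewrite t0 ltW.
have [|c' [p' c'0 c'1 L]] := join_curves p2 p1.
  by apply: (@coord_inj _ _ _ X i); rewrite ?inE.
have c'y : c' 1 = y.
  by rewrite c'1; apply: (@coord_inj _ _ _ X i); rewrite ?inE.
rewrite -[X in riemannian_dist g _ X]c'y -c'0 (le_trans (dist_le_length p'))// L.
exact: leeD2l.
Qed.

Lemma chart_nbhs i x e : dom i x -> 0 < e ->
  nbhs x [set y | dom i y /\ `|coord i x - coord i y| < e].
Proof.
move=> ix e0; apply: filterI; first by apply: open_nbhs_nbhs; split => //; exact: dom_open.
have H : nbhs x (coord i @^-1` ball (coord i x) e).
  by apply: (coord_continuous_at ix); exact: nbhsx_ballx.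
by apply: filterS H => y /=; rewrite -ball_normE.
Qed.

Lemma curve_near a b c t (V : set M) : piecewise_smooth_on X c a b ->
  a <= t <= b -> nbhs (c t) V ->
  exists2 e, 0 < e & forall s, a <= s <= b -> `|t - s| < e -> V (c s).
Proof.
move=> /piecewise_smooth_continuous/subspace_continuousP cc tab Vt.
have [|e /= e0 eV] := (nbhs_ballP _ _).1 (cc t _ _ Vt); first by rewrite /= in_itv.
exists e => // s sab ts; apply: eV; first by rewrite -ball_normE.
by rewrite /= in_itv.
Qed.

(** Instead of prepending a segment to a curve that starts at [x'], which would require a
    reparametrization, a short initial piece of this curve is replaced by a segment from [x]. The
    piece ends so close to [x'] that the extra cost is at most [e]. *)
Lemma dist_start_lipschitz i p m k d x x' y : chart_ball g i p m k d ->
  dom i x -> `|p - coord i x| < d -> dom i x' -> `|p - coord i x'| < d ->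
  (riemannian_dist g x y <=
    riemannian_dist g x' y + (k * `|coord i x' - coord i x|)%:E)%E.
Proof.
move=> cb ix px ix' px'; have [m0 k0 d0 _ _] := cb.
rewrite -leeBlDr//; apply/ereal_infP => _ [c [/piecewise_smooth_curveP pc c0 c1] <-].
rewrite leeBlDr// -c1; apply/lee_addgt0Pr => e e0.
have ek : 0 < e / k by rewrite divr_gt0.
(* The bound [e / k] limits the extra cost to [e]; the other one keeps [c t] in the coordinate
   ball. *)
have dx : 0 < Num.min (e / k) (d - `|p - coord i x'|) by rewrite lt_min ek subr_gt0.
pose V := [set z | dom i z /\ `|coord i x' - coord i z| <
  Num.min (e / k) (d - `|p - coord i x'|)].
have [||h h0 hV] := @curve_near 0 1 c 0 V pc; first by rewrite lexx ler01.
  by rewrite c0; exact: chart_nbhs ix' dx.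
have [t [t0 th t1]] : exists s, [/\ 0 < s, s < h & s <= 1].
  exists (Num.min h 1 / 2); have : 0 < Num.min h 1 by rewrite lt_min h0 ltr01.
  have : Num.min h 1 <= h by rewrite ge_min lexx.
  have : Num.min h 1 <= 1 by rewrite ge_min lexx orbT.
  by move: (Num.min h 1) => mu; split; lra.
have [||ict] := hV t; first by rewrite (ltW t0).
  by rewrite sub0r normrN gtr0_norm.
rewrite lt_min => /andP[cte ctd].
have pct : `|p - coord i (c t)| < d.
  rewrite -(subrKA (coord i x')) (le_lt_trans (ler_normD _ _))//.
  by rewrite addrC -ltrBrDr.
have t01 : 0 < t <= 1 by rewrite t0.
apply: le_trans (dist_replace_start cb pc t01 ict pct ix px) _.
rewrite addeC -[leRHS]addeA -EFinD; apply: leeD.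
  have [|p1 p2] := piecewise_smooth_split pc (t := t); first by rewrite t1 ltW.
  by rewrite /curve_length -/(length_on g c 0 1) (length_on_cat g p1 p2) leeDr// length_on_ge0.
rewrite lee_fin; have -> : e = k * (e / k) by rewrite mulrC divfK// gt_eqF.
rewrite -mulrDr ler_wpM2l ?(ltW k0)//.
rewrite -(subrKA (coord i x')) addrC (le_trans (ler_normD _ _))// lerD2l.
by rewrite distrC ltW.
Qed.

(** The argument of [dist_start_lipschitz] at the other end: a short final piece of the curve is
    replaced by a segment to [y]. *)
Lemma dist_end_lipschitz i p m k d x y y' : chart_ball g i p m k d ->
  dom i y -> `|p - coord i y| < d -> dom i y' -> `|p - coord i y'| < d ->
  (riemannian_dist g x y <=
    riemannian_dist g x y' + (k * `|coord i y - coord i y'|)%:E)%E.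
Proof.
move=> cb iy py iy' py'; have [m0 k0 d0 _ _] := cb.
rewrite -leeBlDr//; apply/ereal_infP => _ [c [/piecewise_smooth_curveP pc c0 c1] <-].
rewrite leeBlDr// -c0; apply/lee_addgt0Pr => e e0.
have ek : 0 < e / k by rewrite divr_gt0.
have dx : 0 < Num.min (e / k) (d - `|p - coord i y'|) by rewrite lt_min ek subr_gt0.
pose V := [set z | dom i z /\ `|coord i y' - coord i z| <
  Num.min (e / k) (d - `|p - coord i y'|)].
have [||h h0 hV] := @curve_near 0 1 c 1 V pc; first by rewrite lexx ler01.
  by rewrite c1; exact: chart_nbhs iy' dx.
have [s [s0 sh s1]] : exists s, [/\ 0 < s, s < h & s <= 1].
  exists (Num.min h 1 / 2); have : 0 < Num.min h 1 by rewrite lt_min h0 ltr01.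
  have : Num.min h 1 <= h by rewrite ge_min lexx.
  have : Num.min h 1 <= 1 by rewrite ge_min lexx orbT.
  by move: (Num.min h 1) => mu; split; lra.
pose t := 1 - s.
have t01 : 0 <= t < 1 by rewrite /t subr_ge0 s1 gtrBl.
have t01' : 0 <= t <= 1 by move: t01 => /andP[-> /ltW ->].
have [||ict] := hV t => //.
  by rewrite /t opprB addrC subrK gtr0_norm.
rewrite lt_min => /andP[cte ctd].
have pct : `|p - coord i (c t)| < d.
  rewrite -(subrKA (coord i y')) (le_lt_trans (ler_normD _ _))//.
  by rewrite addrC -ltrBrDr.
apply: le_trans (dist_replace_end cb pc t01 ict pct iy py) _.
rewrite -[leRHS]addeA -EFinD; apply: leeD.
  have [//|p1 p2] := piecewise_smooth_split pc (t := t).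
  by rewrite /curve_length -/(length_on g c 0 1) (length_on_cat g p1 p2) leeDl// length_on_ge0.
rewrite lee_fin; have -> : e = k * (e / k) by rewrite mulrC divfK// gt_eqF.
rewrite -mulrDr ler_wpM2l ?(ltW k0)//.
rewrite -(subrKA (coord i y')) (le_trans (ler_normD _ _))// lerD2l.
by rewrite ltW.
Qed.

End distance.


(** * Topology of the domains of influence *)

Section influence.
Variables (R : realType) (n : nat) (M : topologicalType).
Variables (X : smooth_manifold R n M) (g : riemannian_metric X).
Variables (Gamma : set M) (tau : M -> R).
Hypothesis (tau_cont : {within closure Gamma, continuous tau}).
Implicit Types (c : R -> M) (a b t m k d : R) (i j : chart X) (p q r : 'rV[R]_n).

Lemma riemannian_dist_ge0 x y : (0 <= riemannian_dist g x y)%E.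
Proof. by apply/ereal_infP => _ [c _ <-]; exact: (length_on_ge0 g c 0 1). Qed.

Lemma near_tau y e : closure Gamma y -> 0 < e ->
  nbhs y [set z | closure Gamma z -> `|tau y - tau z| < e].
Proof.
move=> Gy e0; have /subspace_continuousP/(_ y Gy) ct := tau_cont.
by have /cvgrPdist_lt/(_ _ e0) := ct.
Qed.

(** Continuity of the distance in its first argument, uniformly in the second; it is written with
    sums since the distance takes values in [\bar R]. *)
Lemma dist_start_near x e : 0 < e -> nbhs x [set x' | forall y,
  (riemannian_dist g x y <= riemannian_dist g x' y + e%:E)%E /\
  (riemannian_dist g x' y <= riemannian_dist g x y + e%:E)%E].
Proof.
move=> e0; have [i ix] := dom_cover X x.
have [m [k [d cb]]] := exists_chart_ball g ix.
have [m0 k0 d0 _ _] := cb.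
have h0 : 0 < Num.min d (e / k) by rewrite lt_min d0 divr_gt0.
apply: filterS (chart_nbhs ix h0) => x' [ix' +] y.
rewrite lt_min => /andP[xd xe].
have xx : `|coord i x - coord i x| < d by rewrite subrr normr0.
have ke : k * `|coord i x - coord i x'| <= e.
  by rewrite mulrC -ler_pdivlMr// ltW.
split.
  apply: (le_trans (dist_start_lipschitz y cb ix xx ix' xd)).
  by rewrite leeD2l// lee_fin distrC.
by apply: (le_trans (dist_start_lipschitz y cb ix' xd ix xx)); rewrite leeD2l.
Qed.

Lemma dist_end_near y e : 0 < e -> nbhs y [set y' | forall x,
  (riemannian_dist g x y <= riemannian_dist g x y' + e%:E)%E /\
  (riemannian_dist g x y' <= riemannian_dist g x y + e%:E)%E].
Proof.
move=> e0; have [i iy] := dom_cover X y.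
have [m [k [d cb]]] := exists_chart_ball g iy.
have [m0 k0 d0 _ _] := cb.
have h0 : 0 < Num.min d (e / k) by rewrite lt_min d0 divr_gt0.
apply: filterS (chart_nbhs iy h0) => y' [iy' +] x.
rewrite lt_min => /andP[yd ye].
have yy : `|coord i y - coord i y| < d by rewrite subrr normr0.
have ke : k * `|coord i y - coord i y'| <= e.
  by rewrite mulrC -ler_pdivlMr// ltW.
split.
  by apply: (le_trans (dist_end_lipschitz x cb iy yy iy' yd)); rewrite leeD2l.
apply: (le_trans (dist_end_lipschitz x cb iy' yd iy yy)).
by rewrite leeD2l// lee_fin distrC.
Qed.

Lemma dist_lt_room x y a : (riemannian_dist g x y < a%:E)%E ->
  exists2 e, 0 < e & (riemannian_dist g x y + (2 * e)%:E <= a%:E)%E.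
Proof.
have := riemannian_dist_ge0 x y.
case: (riemannian_dist g x y) => [s| |]//= _; rewrite lte_fin => sa.
by exists ((a - s) / 2); [lra|rewrite -EFinD lee_fin; lra].
Qed.

(** The strict inequality leaves room [2 * e]. Moving [y] to a nearby point of [Gamma] costs at most
    [e] in the distance and less than [e] in [tau]. *)
Lemma open_influence_closure x y : closure Gamma y ->
  (riemannian_dist g x y < (tau y)%:E)%E -> open_influence g Gamma tau x.
Proof.
move=> Gy /dist_lt_room[e e0 xye].
have [y' [Gy' [/(_ x)[_ yy'] tyy']]] := Gy _
  (filterI (dist_end_near y e0) (near_tau Gy e0)).
exists y' => //; apply: (le_lt_trans yy').
have := tyy' (subset_closure Gy'); rewrite ltr_norml => /andP[_ ty].
apply: (@le_lt_trans _ _ (tau y - e)%:E); last by rewrite lte_fin; lra.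
by rewrite EFinB leeBrDr// -addeA -EFinD -mulr2n -mulr_natl.
Qed.

Lemma open_influence_open : open (open_influence g Gamma tau).
Proof.
rewrite openE => x [y Gy /dist_lt_room[e e0 xye]].
apply: filterS (dist_start_near x e0) => x' /(_ y)[_ xx']; exists y => //.
have xyf : riemannian_dist g x y \is a fin_num.
  rewrite ge0_fin_numE ?riemannian_dist_ge0//.
  rewrite (@le_lt_trans _ _ (tau y)%:E) ?ltry//.
  by rewrite (le_trans _ xye)// leeDl// lee_fin mulr_ge0// ltW.
apply: (le_lt_trans xx'); apply: lt_le_trans xye.
by rewrite lteD2lE// lte_fin; lra.
Qed.

Lemma open_sub_closed_influence :
  open_influence g Gamma tau `<=` closed_influence g Gamma tau.
Proof. by move=> x [y Gy /ltW xy]; exists y => //; exact: subset_closure. Qed.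

(** Points of the set close to [x] come with endpoints in the closure of [Gamma], which is compact.
    A cluster point of these endpoints serves [x], by continuity of the distance and of [tau]. *)
Lemma closed_influence_closed : compact [set: M] ->
  closed (closed_influence g Gamma tau).
Proof.
(* [W U] collects the endpoints that serve some point of [U]; these sets generate a proper filter
   because [x] is in the closure. *)
move=> cM x Clx; pose W U := [set y | closure Gamma y /\
  exists2 x', U x' & (riemannian_dist g x' y <= (tau y)%:E)%E].
pose F := filter_from (nbhs x) W.
have FF : ProperFilter F.
  apply: filter_from_proper; last first.
    move=> U xU; have [x' [[y Gy x'y] Ux']] := Clx U xU.
    by exists y; split => //; exists x'.
  apply: filter_from_filter; first by exists setT; exact: filterT.
  move=> U V xU xV; exists (U `&` V); first exact: filterI.
  by move=> y [Gy [x' [Ux' Vx'] x'y]]; split; split => //; exists x'.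
have [|y [Gy cFy]] := subclosed_compact (@closed_closure _ Gamma) cM (@subsetT _ _) FF.
  by exists setT; [exact: filterT|move=> y []].
exists y => //; apply/lee_addgt0Pr => e e0.
(* One third each for replacing [x] by [x'], for replacing [y] by [y'], and for the variation of
   [tau]. *)
have e3 : 0 < e / 3 by rewrite divr_gt0.
have FW : F (W [set x' | forall y,
    (riemannian_dist g x y <= riemannian_dist g x' y + (e / 3)%:E)%E /\
    (riemannian_dist g x' y <= riemannian_dist g x y + (e / 3)%:E)%E]).
  by eexists; [exact: (dist_start_near x e3)|exact: subset_refl].
have [y' [[Gy' [x' + x'y']] [/(_ x)[yy' _] tyy']]] := cFy _ _ FW
  (filterI (dist_end_near y e3) (near_tau Gy e3)).
move=> /(_ y')[xx' _].
have := tyy' Gy'; rewrite ltr_norml => /andP[ty _].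
apply: (le_trans yy'); apply: (le_trans (leeD2r _ xx')).
apply: (le_trans (leeD2r _ (leeD2r _ x'y'))).
by rewrite -!EFinD lee_fin; lra.
Qed.

Lemma boundary_influence_sub : compact [set: M] ->
  topological_boundary (closed_influence g Gamma tau) `<=`
  closed_influence g Gamma tau `\` open_influence g Gamma tau.
Proof.
move=> cM x [clx nix]; split; first exact: closed_influence_closed.
move=> ox; apply: nix.
have : nbhs x (open_influence g Gamma tau).
  by apply: open_nbhs_nbhs; split; first exact: open_influence_open.
by apply: filterS; exact: open_sub_closed_influence.
Qed.

End influence.

(** * Interior points versus boundary points *)

Section interior_points.
Variables (R : realType) (n : nat) (M : topologicalType).
Variables (X : smooth_manifold R n M) (g : riemannian_metric X).
Implicit Types (i j : chart X) (p q r : 'rV[R]_n).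

Definition half_space_interior : set 'rV[R]_n :=
  [set q | forall k : 'I_n, k = 0%N :> nat -> 0 < q ord0 k].

(** One chart suffices in this definition; that no other chart puts such a point on the boundary is
    [manifold_interior_boundary]. *)
Definition manifold_interior : set M :=
  [set x | exists2 i : chart X, dom i x & half_space_interior (coord i x)].

Lemma half_space_interior_sub : half_space_interior `<=` @half_space R n.
Proof. by move=> q hq k /hq /ltW. Qed.

Lemma open_half_space_interior : open half_space_interior.
Proof.
rewrite openE => q hq; rewrite /interior.
apply: (@filter_forall _ _ _ _ (nbhs_filter q)) => k.
have [k0|k0] := eqVneq (k : nat) 0%N; last first.
  by apply: filterS (@filterT _ _ (nbhs_filter q)) => q' _ /eqP; rewrite (negbTE k0).
have : nbhs q ((fun q' : 'rV[R]_n => q' ord0 k) @^-1` [set s | 0 < s]).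
  apply: (@matrix_normedtype.coord_continuous _ _ _ _ _ q).
  by apply: open_nbhs_nbhs; split; [exact: open_gt|exact: hq].
by apply: filterS => q' q'0 _.
Qed.

Lemma open_manifold_interior : open manifold_interior.
Proof.
rewrite openE => x [i ix hx].
have U1 : nbhs x (dom i) by apply: open_nbhs_nbhs; split => //; exact: dom_open.
have U2 : nbhs x (coord i @^-1` half_space_interior).
  apply: (coord_continuous_at ix); apply: open_nbhs_nbhs; split => //.
  exact: open_half_space_interior.
by apply: filterS (filterI U1 U2) => y [iy hy]; exists i.
Qed.

(* The first coordinate of a transition map is nonnegative; if it vanished at an
   interior point, it would have a minimum there and the differential would not
   be injective, contradicting [tensor_change]. *)
Lemma manifold_interior_boundary : manifold_interior `&` manifold_boundary X = set0.
Proof.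
apply/seteqP; split => // x [[i ix hx] [j jx [k k0 jk]]].
have [|U [F [oU Ux sF FE]]] := @transition_smooth _ _ _ X i j x; first by split.
pose p := coord i x.
have [J JE] := C1_derive_mulmx oU Ux (sF 1%N).
have [V oV VE] := @coord_open _ _ _ X i (dom i `&` dom j)
  (openI (dom_open i) (dom_open j)) (@subIsetl _ _ _).
have Vp : V p.
  have : (coord i @` (dom i `&` dom j)) p by exists x.
  by rewrite VE => -[].
have nearF : nbhs p [set q | U q /\ 0 <= F q ord0 k].
  have nV : nbhs p V by exact: open_nbhs_nbhs.
  have nU : nbhs p U by exact: open_nbhs_nbhs.
  have nH : nbhs p half_space_interior.
    by apply: open_nbhs_nbhs; split => //; exact: open_half_space_interior.
  have := @filterI _ _ (nbhs_filter p) _ _ nV (@filterI _ _ (nbhs_filter p) _ _ nU nH).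
  apply: filterS => q [Vq [Uq Hq]]; split => //.
  have : (V `&` @half_space R n) q by split => //; exact: half_space_interior_sub.
  rewrite -VE => -[y [iy jy] yq]; rewrite -yq -FE ?yq//.
  exact: (coord_half_space jy).
have Fp : F p ord0 k = 0 by rewrite -FE.
have DF v : ('D_v F p) ord0 k = 0.
  have [_ /(_ v)[dF _]] := sF 1%N.
  pose h (s : R) := F (s *: v + p) ord0 k.
  have l0 : (0 : R) *: v + p = p by rewrite scale0r add0r.
  have : nbhs (0 : R) ((fun s : R => s *: v + p) @^-1` [set q | U q /\ 0 <= F q ord0 k]).
    by apply: (@continuous_line _ _ p v 0); rewrite l0.
  move=> /nbhs_ballP[e /= e0 eF].
  have inb t : t \in `]- e, e[ -> U (t *: v + p) /\ 0 <= h t.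
    by rewrite in_itv/= -ltr_norml => te; apply: eF; rewrite -ball_normE/= sub0r normrN.
  have dh t : t \in `]- e, e[ -> is_derive t 1 h (('D_v F (t *: v + p)) ord0 k).
    move=> /inb[Ut _]; have dFt := dF _ Ut.
    have -> : ('D_v F (t *: v + p)) ord0 k =
        'D_v (fun q => F q ord0 k) (t *: v + p) by rewrite derive_mx// mxE.
    apply: (@is_derive_line _ _ _ (fun q => F q ord0 k)).
    by move/derivable_mxP : dFt; exact.
  have h0 : h 0 = 0 by rewrite /h l0.
  have e_in : 0 \in `]- e, e[ by rewrite in_itv/= oppr_lt0 e0.
  have hmin : is_derive (0 : R) (1 : R) h (0 : R).
    apply: (@derive1_at_min R h (- e) e 0) => //.
    - by rewrite (@le_trans _ _ 0)// ?oppr_le0 ltW.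
    - by move=> t /dh dht; exact: ex_derive.
    - by move=> t /inb[_]; rewrite h0.
  have := @derive_val _ _ _ _ _ _ _ hmin.
  by rewrite (@derive_val _ _ _ _ _ _ _ (dh 0 e_in)) l0.
have [v v0 vJ] : exists2 v : 'rV[R]_n, v != 0 & v *m J = 0.
  apply/det0P; apply: contraT => J0.
  have uJ : J \in unitmx by rewrite unitmxE unitfE.
  (* If [J] were invertible, some direction would have the [k]-th basis vector as its derivative,
     whereas all derivatives have [k]-th entry 0. *)
  have := DF (delta_mx ord0 k *m invmx J); rewrite JE mulmxKV// mxE !eqxx/=.
  by move/eqP; rewrite oner_eq0.
have := @tensor_pos _ _ _ _ g i x v ix v0.
rewrite (@tensor_change _ _ _ _ g i j x U F ix jx oU Ux sF) => [|y iy jy Uy].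
  by rewrite !JE vJ /bilin !mul0mx mxE ltxx.
exact: FE.
Qed.

(** The interior points form an open set disjoint from [Gamma]; an open set that misses [Gamma]
    misses its closure. *)
Lemma manifold_interior_closure (Gamma : set M) x :
  Gamma `<=` manifold_boundary X -> closure Gamma x -> ~ manifold_interior x.
Proof.
move=> Gb Gx ix.
have [y [/Gb by_ iy]] := Gx _ (open_nbhs_nbhs (conj open_manifold_interior ix)).
have : (manifold_interior `&` manifold_boundary X) y by [].
by rewrite manifold_interior_boundary.
Qed.

End interior_points.


(** * Null sets of Borel measures *)

Import HBNNSimple.

(** No measurability of [f] is assumed: the integral is a supremum over simple functions below [f]
    extended by 0, and each of them vanishes outside of the null set [D]. *)
Lemma null_set_integral_ge0 d (T : measurableType d) (R : realType)
    (mu : {measure set T -> \bar R}) (D : set T) (f : T -> \bar R) :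
  measurable D -> mu D = 0%E -> (forall x, D x -> (0 <= f x)%E) ->
  (\int[mu]_(x in D) f x = 0)%E.
Proof.
move=> mD D0 f0; apply/eqP; rewrite eq_le; apply/andP; split; last exact: integral_ge0.
rewrite ge0_integralE//; apply/ereal_supP => _ [h hf <-].
rewrite -integralT_nnsfun.
have -> : (\int[mu]_x (h x)%:E = \int[mu]_(x in D) (h x)%:E)%E.
  rewrite [RHS]integral_mkcond; apply: eq_integral => x _.
  rewrite patchE; case: ifPn => // xD; apply/eqP; rewrite eq_le.
  have := hf x; rewrite patchE (negbTE xD) => ->/=.
  by rewrite lee_fin.
rewrite null_set_integral//.
by apply/measurable_EFinP; apply: measurable_funTS.
Qed.

Section borel_sets.
Variables (T : ptopologicalType).

Lemma borel_open (U : set T) : open U -> measurable (U : set (borel T)).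
Proof. by move=> oU; exact: sub_sigma_algebra. Qed.

Lemma borel_closed (F : set T) : closed F -> measurable (F : set (borel T)).
Proof.
by move=> cF; rewrite -(setCK F); apply: measurableC; apply: borel_open; exact: closed_openC.
Qed.

(** By second countability, [D] is covered by countably many basis sets whose intersections with [D]
    are null. *)
Lemma negligible_local (R : realType) (mu : {measure set (borel T) -> \bar R})
    (D : set T) : @second_countable T ->
  (forall x, D x -> exists2 U, nbhs x U & mu.-negligible (D `&` U)) ->
  mu.-negligible D.
Proof.
move=> [B /countable_injP[f finj] [Bo Bbasis]] Dloc.
(* Pieces are indexed by the codes of basis sets; since [f] is injective on the basis, each [S k]
   lies in a single basis set. *)
pose S k := [set x | D x /\ exists b, [/\ B b, b x, f b = k & mu.-negligible (D `&` b)]].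
have S0 k : mu.-negligible (S k).
  have [[x [Dx [b [Bb bx fb nb]]]]|Sk0] := pselect (S k !=set0).
    apply: negligibleS nb => y [Dy [b' [Bb' b'y fb' _]]]; split => //.
    by rewrite (finj b b') ?inE// fb fb'.
  apply: negligibleS (@negligible_set0 _ _ _ mu) => x Sx.
  by apply: Sk0; exists x.
apply: negligibleS (negligible_bigcup S0) => x Dx.
have [U xU nU] := Dloc x Dx.
have [b [Bb bx] bU] := Bbasis x U xU.
exists (f b) => //; split => //; exists b; split => //.
by apply: negligibleS nU => y [Dy /bU]; split.
Qed.

End borel_sets.

(** * Porous sets are Lebesgue null *)

Section lebesgue.
Variables (R : realType) (n : nat) (lam : {measure set (borel 'rV[R]_n) -> \bar R}).
Hypothesis lamE : is_lebesgue lam.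
Implicit Types (a b x z w : 'rV[R]_n) (E : set 'rV[R]_n).

Definition box a b := [set x : 'rV[R]_n | forall i, a ord0 i <= x ord0 i <= b ord0 i].

Lemma measurable_box a b : measurable (box a b : set (borel 'rV[R]_n)).
Proof.
apply: borel_closed; apply: compact_closed; first exact: norm_hausdorff.
rewrite (_ : box a b = [set v : 'rV[R]_n | forall i,
    `[a ord0 i, b ord0 i]%classic (v ord0 i)]).
  by apply: (@rV_compact _ _ (fun i => `[a ord0 i, b ord0 i]%classic)) => i;
    exact: segment_compact.
by apply/seteqP; split => x xab i; have := xab i; rewrite /= in_itv.
Qed.

Definition cube a (s : R) := box a (a + const_mx s).

Lemma cubeP a s x : cube a s x <-> forall i, a ord0 i <= x ord0 i <= a ord0 i + s.
Proof. by split=> H i; have := H i; rewrite !mxE. Qed.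

Lemma lebesgue_cube a s : 0 <= s -> lam (cube a s) = (s ^+ n)%:E.
Proof.
move=> s0; rewrite lamE => [|i]; last by rewrite !mxE lerDl.
congr (_%:E); rewrite (eq_bigr (fun=> s)) => [|i _]; last first.
  by rewrite !mxE addrAC subrr add0r.
by rewrite prodr_const card_ord.
Qed.

Lemma interval_cell (N : nat) (h u : R) : 0 < h -> 0 <= u <= h * N.+1%:R ->
  exists k : 'I_N.+1, h * k%:R <= u <= h * k%:R + h.
Proof.
move=> h0; elim: N => [|N ih] /andP[u0 uN].
  by exists ord0; rewrite mulr0 add0r u0 -[leRHS]mulr1.
have [uN'|Nu] := leP u (h * N.+1%:R); last first.
  exists ord_max; apply/andP; split; first exact: ltW.
  by rewrite (le_trans uN)//= -(natr1 N.+1) mulrDr mulr1.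
have [|k /andP[k1 k2]] := ih; first by rewrite u0.
by exists (widen_ord (leqnSn _) k); rewrite /= k1.
Qed.

(** The closed cells overlap along their faces; it only matters that they cover the cube. *)
Lemma cube_cell (N : nat) a s x : 0 < s -> cube a s x ->
  exists f : {ffun 'I_n -> 'I_N.+1},
    cube (a + \row_i (s / N.+1%:R * (f i)%:R)) (s / N.+1%:R) x.
Proof.
move=> s0 /cubeP ax; have h0 : 0 < s / N.+1%:R :> R by rewrite divr_gt0.
have H i : exists k : 'I_N.+1,
    s / N.+1%:R * k%:R <= x ord0 i - a ord0 i <= s / N.+1%:R * k%:R + s / N.+1%:R.
  apply: interval_cell => //; rewrite divfK// subr_ge0 lerBlDl.
  by rewrite ax.
exists [ffun i => sval (cid (H i))]; apply/cubeP => i; rewrite !mxE ffunE.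
case: cid => k /= /andP[k1 k2]; rewrite -lerBrDl k1/=.
by rewrite -addrA -lerBlDl.
Qed.

Lemma cube_diam a s x z : cube a s x -> cube a s z -> 0 <= s -> `|x - z| <= s.
Proof.
move=> /cubeP ax /cubeP az s0; apply: mx_norm_leP => // p i; rewrite (ord1 p) !mxE.
have := ax i; have := az i; rewrite ler_norml; move: (a ord0 i) => u.
by move: (x ord0 i) (z ord0 i) => v w /andP[? ?] /andP[? ?]; apply/andP; split; lra.
Qed.

(* Uniform porosity: at every scale up to [r0], around each point of E there is a
   hole of comparable size. *)
Definition porous E (th r0 : R) := forall x r, E x -> 0 < r <= r0 ->
  exists2 z, `|z - x| <= r & forall w, `|w - z| <= th * r -> ~ E w.

(** It is enough to find a point [z] of the cube with no point of [E] within [s / N.+1] of it: a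
    cell containing [z] has diameter at most [s / N.+1]. *)
Lemma porous_cell E th r0 (N : nat) a s : porous E th r0 -> 4 <= N.+1%:R :> R ->
  4 <= th * N.+1%:R -> 0 < s -> s / 4 <= r0 ->
  exists f : {ffun 'I_n -> 'I_N.+1}, forall w,
    cube (a + \row_i (s / N.+1%:R * (f i)%:R)) (s / N.+1%:R) w -> ~ E w.
Proof.
move=> pE N4 thN s0 sr; pose c := a + const_mx (s / 2).
have sN0 : 0 < s / N.+1%:R :> R by rewrite divr_gt0.
have s40 : 0 < s / 4 by rewrite divr_gt0.
suff [z az zE] : exists2 z, cube a s z & forall w, `|w - z| <= s / N.+1%:R -> ~ E w.
  have [f fz] := cube_cell N s0 az; exists f => w fw; apply: zE.
  exact: cube_diam fw fz (ltW sN0).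
have inc z : `|z - c| <= s / 2 -> cube a s z.
  move=> zc; apply/cubeP => i; have := le_trans (ler_mx_norm_entry _ ord0 i) zc.
  by rewrite !mxE ler_norml => /andP[? ?]; apply/andP; split; lra.
(* If [E] comes within [s / 4] of the center, porosity at radius [s / 4] puts a hole at distance at
   most [s / 2] from the center, hence in the cube, and [4 <= th * N.+1] makes it large enough.
   Otherwise the center itself serves as [z]. *)
have [[x [Ex xc]]|noE] := pselect (exists x, E x /\ `|x - c| <= s / 4).
  have [|z zx zE] := pE x (s / 4) Ex; first by rewrite s40.
  exists z.
    apply: inc; rewrite -(subrKA x) (le_trans (ler_normD _ _))//.
    by rewrite (le_trans (lerD zx xc))//; lra.
  move=> w wz; apply: zE; rewrite (le_trans wz)// ler_pdivrMr//.
  have -> : th * (s / 4) * N.+1%:R = (th * N.+1%:R) * (s / 4) by ring.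
  apply: (@le_trans _ _ (4 * (s / 4))); first lra.
  by rewrite ler_wpM2r// ltW.
exists c; first by apply: inc; rewrite subrr normr0 divr_ge0// ltW.
move=> w wc Ew; apply: noE; exists w; split => //; rewrite (le_trans wc)//.
by rewrite ler_pdivrMr// mulrAC -mulrA ler_peMr ?(ltW s0)//; lra.
Qed.

(** In each stage one of the [N.+1 ^ n] cells is discarded by [porous_cell] and the induction
    hypothesis is applied in the others. The smaller cubes satisfy the scale condition as well. *)
Lemma porous_cover E th r0 (N : nat) j : porous E th r0 -> 4 <= N.+1%:R :> R ->
  4 <= th * N.+1%:R -> forall a s, 0 < s -> s / 4 <= r0 ->
  exists F : set (borel 'rV[R]_n), [/\ measurable F, E `&` cube a s `<=` F &
    (lam F <= ((1 - (N.+1%:R ^+ n)^-1) ^+ j * s ^+ n)%:E)%E].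
Proof.
move=> pE N4 thN; elim: j => [|j ih] a s s0 sr.
  exists (cube a s); split; first exact: measurable_box.
    by move=> x [].
  by rewrite lebesgue_cube ?(ltW s0)// expr0 mul1r.
set K := (1 - _)%R; have [f0 f0E] := porous_cell a pE N4 thN s0 sr.
pose h := s / N.+1%:R; have h0 : 0 < h by rewrite divr_gt0.
have hr : h / 4 <= r0.
  rewrite (le_trans _ sr)// ler_wpM2r// /h ler_pdivrMr// ler_peMr ?(ltW s0)//.
  by rewrite ler1n.
pose cell (f : {ffun 'I_n -> 'I_N.+1}) := cube (a + \row_i (h * (f i)%:R)) h.
have H (f : {ffun 'I_n -> 'I_N.+1}) := ih (a + \row_i (h * (f i)%:R)) h h0 hr.
pose F f := sval (cid (H f)).
have FP f : [/\ measurable (F f), E `&` cell f `<=` F f &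
    (lam (F f) <= (K ^+ j * h ^+ n)%:E)%E] by rewrite /F; case: cid.
exists (\big[setU/set0]_(f : {ffun 'I_n -> 'I_N.+1} | f != f0) F f); split.
- by apply: bigsetU_measurable => f _; have [] := FP f.
- move=> x [Ex ax]; have [f fx] := cube_cell N s0 ax.
  have ff0 : f != f0 by apply/eqP => ff0; apply: (f0E x) => //; rewrite -ff0.
  rewrite -bigcup_seq_cond; exists f => /=; first by rewrite mem_index_enum.
  by have [_ + _] := FP f; apply.
have : measurable (\big[setU/set0]_(f : {ffun 'I_n -> 'I_N.+1} | f != f0) F f) /\
    (lam (\big[setU/set0]_(f : {ffun 'I_n -> 'I_N.+1} | f != f0) F f) <=
      (\sum_(f : {ffun 'I_n -> 'I_N.+1} | f != f0) K ^+ j * h ^+ n)%:E)%E.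
  elim/big_ind2 : _ => [|A u B v [mA Au] [mB Bv]|f _].
  - by rewrite measure0.
  - split; first exact: measurableU.
    by rewrite (le_trans (measureU2 _ mA mB))// EFinD leeD.
  - by have [] := FP f.
move=> [_ /le_trans]; apply; rewrite lee_fin sumr_const.
(* The [N.+1 ^ n - 1] remaining cells, each of volume [s ^ n / N.+1 ^ n], produce one more factor
   [K]. *)
rewrite (_ : #|_| = (N.+1 ^ n).-1); last first.
  by rewrite (cardC1 f0) card_ffun !card_ord.
have Nn0 : N.+1%:R ^+ n != 0 :> R by rewrite expf_neq0.
rewrite -mulr_natl -subn1 natrB ?expn_gt0// natrX exprS /K /h expr_div_n.
by rewrite le_eqVlt; apply/orP; left; apply/eqP; field.
Qed.

(** The intersection of the covers from [porous_cover] over all [j] is a Borel set containing [E],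
    and its measure is at most [K ^+ j * s ^+ n] for every [j]. *)
Lemma porous_negligible E th r0 a s : porous E th r0 -> 0 < th -> 0 < s ->
  s / 4 <= r0 -> E `<=` cube a s -> lam.-negligible E.
Proof.
move=> pE th0 s0 sr Es.
have [N [N4 thN]] : exists N : nat, 4 <= N.+1%:R :> R /\ 4 <= th * N.+1%:R.
  exists (maxn 4 (Num.truncn (4 / th)).+1); split.
    by rewrite ler_nat leqW// leq_maxl.
  rewrite mulrC -ler_pdivrMr// (le_trans (ltW (truncnS_gt _)))// ler_nat.
  by rewrite leqW// leq_maxr.
pose K : R := 1 - (N.+1%:R ^+ n)^-1.
have H j := porous_cover j pE N4 thN a s0 sr.
pose F j := sval (cid (H j)).
have FP j : [/\ measurable (F j), E `&` cube a s `<=` F j &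
    (lam (F j) <= (K ^+ j * s ^+ n)%:E)%E] by rewrite /F; case: cid.
have mG : measurable (\bigcap_j F j).
  by apply: bigcap_measurable => // j _; have [] := FP j.
exists (\bigcap_j F j); split => //; last first.
  by move=> x Ex j _; have [_ + _] := FP j; apply; split => //; exact: Es.
apply/eqP; rewrite eq_le measure_ge0 andbT; apply/lee_addgt0Pr => e e0; rewrite add0e.
have Nn0 : 0 < N.+1%:R ^+ n :> R by rewrite exprn_gt0.
have K1 : `|K| < 1.
  rewrite ger0_norm; first by rewrite /K ltrBlDr ltrDl invr_gt0.
  by rewrite /K subr_ge0 invf_le1// exprn_ege1// ler1n.
have sn0 : 0 < s ^+ n by rewrite exprn_gt0.
have /cvgrPdist_lt/(_ (e / s ^+ n)) := cvg_expr K1.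
rewrite divr_gt0// => /(_ isT)[j _ /(_ j (leqnn j))].
rewrite /= sub0r normrN => /ltW Kj.
have [mF _ FK] := FP j; apply: (@le_trans _ _ (lam (F j))).
  by apply: le_measure; rewrite ?inE//; exact: bigcap_inf.
apply: (le_trans FK); rewrite lee_fin -ler_pdivlMr//.
by rewrite (le_trans (ler_norm _)).
Qed.

(** The hyperplane is a countable union of boxes that are degenerate in the coordinate of index 0,
    so a factor of each volume is zero. *)
Lemma half_space_boundary_negligible : lam.-negligible (@half_space_boundary R n).
Proof.
have [->|/set0P[q0 [k k0 _]]] := eqVneq (@half_space_boundary R n) set0.
  exact: negligible_set0.
pose c N : 'rV[R]_n := \row_i (if i == k then 0 else N%:R).
pose B N := box (- c N) (c N).
have B0 N : lam.-negligible (B N).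
  apply/negligibleP; first exact: measurable_box.
  have ccN i : (- c N) ord0 i <= c N ord0 i.
    by rewrite !mxE; case: ifP => _; rewrite ?oppr0// -subr_ge0 opprK addr_ge0.
  rewrite [LHS](lamE ccN).
  by rewrite (bigD1 k)//= !mxE eqxx !oppr0 addr0 mul0r.
apply: negligibleS (negligible_bigcup B0) => q [k' k'0 qk].
have kk : k' = k by apply: val_inj; rewrite /= k0.
exists (Num.truncn `|q|).+1 => // i; rewrite !mxE.
case: eqP => [->|_]; first by rewrite oppr0 -kk qk lexx.
rewrite -ler_norml (le_trans (ler_mx_norm_entry _ _ _))// ltW//.
exact: truncnS_gt.
Qed.

End lebesgue.


(** * The difference of the domains of influence is porous *)

Section porosity.
Variables (R : realType) (n : nat) (M : topologicalType).
Variables (X : smooth_manifold R n M) (g : riemannian_metric X).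
Implicit Types (c : R -> M) (a b t m k d : R) (i j : chart X) (p q : 'rV[R]_n).

(** The inverse chart carries a closed ball of R^n, which is compact, onto this set; compact sets
    are closed in a Hausdorff space. Consequently a curve cannot leave the ball without crossing its
    sphere. *)
Lemma closed_coord_ball i p m k d h : chart_ball g i p m k d -> 0 <= h < d ->
  (forall q, `|p - q| < d -> half_space q) ->
  closed [set y | dom i y /\ `|p - coord i y| <= h].
Proof.
move=> [m0 k0 d0 onto _] /andP[h0 hd] hs.
have [x0 _ _] : exists2 y, dom i y & coord i y = p.
  by apply: onto; [apply: hs|]; rewrite subrr normr0.
pose K := [set q : 'rV[R]_n | `|p - q| <= h].
pose inv q := xget x0 [set y | dom i y /\ coord i y = q].
have invP q : K q -> dom i (inv q) /\ coord i (inv q) = q.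
  move=> /= qh; have [||y iy yq] := onto q; [apply: hs| |]; try exact: le_lt_trans hd.
  exact: (@xgetI _ x0 [set y | dom i y /\ coord i y = q] y).
have cK : compact K.
  apply: bounded_closed_compact.
    exists (`|p| + h); split; [exact: num_real|move=> t tp q qh]; apply: ltW; apply: le_lt_trans tp.
    by rewrite -(subKr p q) (le_trans (ler_normB _ _))// lerD2l.
  rewrite (_ : K = (fun q => `|p - q|) @^-1` [set s | s <= h])//.
  apply: closed_comp; last exact: closed_le.
  move=> q _; apply: (@lipschitz_bound_continuous _ _ _ _ 1) => x y.
  rewrite mul1r (le_trans (ler_dist_dist _ _))//.
  by rewrite opprB addrC addrA subrK distrC.
have -> : [set y | dom i y /\ `|p - coord i y| <= h] = inv @` K.
  apply/seteqP; split => [y [iy yh]|_ [q Kq <-]].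
    exists (coord i y) => //; have [i1 i2] := invP (coord i y) yh.
    by apply: (@coord_inj _ _ _ X i); rewrite ?inE.
  by have [i1 i2] := invP q Kq; rewrite /= i2.
apply: compact_closed; first exact: (manifold_hausdorff X).
apply: continuous_compact => //; apply: (@continuous_coord_reflect _ _ _ X _ _ _ i).
  by move=> q /invP[].
apply: (@subspace_eq_continuous _ K 'rV[R]_n (fun q : 'rV[R]_n => q)).
  by move=> q; rewrite inE => /invP[_ qE]; exact: esym qE.
by apply: continuous_subspaceT => q; exact: cvg_id.
Qed.

(** The exit time is the supremum of the times up to which the curve has stayed in the closed
    coordinate ball. *)
Lemma exit_time i p m k d h c : chart_ball g i p m k d -> 0 < h < d ->
  (forall q, `|p - q| < d -> half_space q) ->
  piecewise_smooth_on X c 0 1 -> dom i (c 0) -> coord i (c 0) = p ->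
  ~ (dom i (c 1) /\ `|p - coord i (c 1)| <= h) ->
  exists t, [/\ 0 < t < 1,
    forall s, 0 <= s <= t -> dom i (c s) /\ `|p - coord i (c s)| <= h &
    `|p - coord i (c t)| = h].
Proof.
move=> cb /andP[h0 hd] hs pc ic0 c0p nc1.
pose B := [set y | dom i y /\ `|p - coord i y| <= h].
have cB : closed B by apply: closed_coord_ball cb _ hs; rewrite ltW.
pose Z := [set s : R | 0 <= s <= 1 /\ forall u, 0 <= u <= s -> B (c u)].
have Z0 : Z 0.
  split; first by rewrite lexx ler01.
  move=> u; rewrite -eq_le => /eqP <-; split => //.
  by rewrite c0p subrr normr0 ltW.
have supZ : has_sup Z.
  by split; [exists 0|exists 1 => s [/andP[]]].
pose t := sup Z.
have Zt s : Z s -> s <= t by move=> Zs; exact: sup_upper_bound.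
have t0 : 0 <= t by exact: Zt.
have t1 : t <= 1 by apply: sup_le_ub; [exists 0|move=> s [/andP[]]].
have t01 : 0 <= t <= 1 by rewrite t0.
have Blt s : 0 <= s -> s < t -> B (c s).
  move=> s0 st; have ts : 0 < t - s by rewrite subr_gt0.
  have [u [_ Bu]] := sup_adherent ts supZ.
  by rewrite -/t subKr => su; apply: Bu; rewrite s0 ltW.
have Bt : B (c t).
  apply: contrapT => nBt.
  have nB : nbhs (c t) (~` B) by apply: open_nbhs_nbhs; split => //; exact: closed_openC.
  have [e e0 eB] := curve_near pc t01 nB.
  have [u Zu] := sup_adherent e0 supZ; rewrite -/t => tu.
  have ut := Zt u Zu; have [u01 Bu] := Zu.
  apply: (eB u u01); last by apply: Bu; rewrite lexx andbT; case/andP: u01.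
  by rewrite ger0_norm ?subr_ge0//; lra.
have Ball s : 0 <= s <= t -> B (c s).
  move=> /andP[s0]; rewrite le_eqVlt => /predU1P[->//|]; exact: Blt.
have t_lt1 : t < 1.
  rewrite lt_neqAle t1 andbT; apply/eqP => tE; apply: nc1.
  by rewrite -tE; exact: Bt.
have [ict pch] := Bt.
have ptE : `|p - coord i (c t)| = h.
  (* Strictly inside the ball the curve would remain there for a little longer, against the choice
     of [t] as a supremum. *)
  apply/eqP; rewrite eq_le pch/= leNgt; apply/negP => plt.
  have e0 : 0 < h - `|p - coord i (c t)| by rewrite subr_gt0.
  have [e e_gt0 eB] := curve_near pc t01 (chart_nbhs ict e0).
  have [s [ts s1 se]] : exists s, [/\ t < s, s <= 1 & s < t + e].
    exists (t + Num.min e (1 - t) / 2).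
    have : 0 < Num.min e (1 - t) by rewrite lt_min e_gt0 subr_gt0.
    have : Num.min e (1 - t) <= e by rewrite ge_min lexx.
    have : Num.min e (1 - t) <= 1 - t by rewrite ge_min lexx orbT.
    by move: (Num.min _ _) => mu ? ? ?; split; lra.
  suff /Zt : Z s by rewrite leNgt ts.
  split; first by rewrite s1 (le_trans t0)// ltW.
  move=> u /andP[u0 us]; have [ut|tu] := leP u t; first by apply: Ball; rewrite u0.
  have [||icu] := eB u; first by rewrite u0 (le_trans us).
    by rewrite distrC gtr0_norm ?subr_gt0//; lra.
  move=> cu; split => //; rewrite -(subrKA (coord i (c t))).
  by rewrite (le_trans (ler_normD _ _))// -lerBrDl ltW.
exists t; split => //; rewrite t_lt1 andbT lt_neqAle t0 andbT.
apply/eqP => tE; move: ptE; rewrite -tE c0p subrr normr0 => hE.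
by move: h0; rewrite -hE ltxx.
Qed.

Variables (Gamma : set M) (tau : M -> R).
Hypotheses (tau_cont : {within closure Gamma, continuous tau})
  (Gamma_sub : Gamma `<=` manifold_boundary X).

Let E := closed_influence g Gamma tau `\` open_influence g Gamma tau.

(* A nearly minimizing curve from [x] to a point [y] with [d(x, y) <= tau y] leaves
   the coordinate ball of radius [r] about [x] at some [z]; it has then used up
   length [m r], so that points close to [z] compared to [r] are strictly closer
   to [y] than [tau y]. *)
Lemma influence_difference_porous x0 : manifold_interior X x0 ->
  exists i th r0, [/\ dom i x0, 0 < th, 0 < r0 &
    porous [set q | `|coord i x0 - q| < r0 /\
                    exists x, [/\ E x, dom i x & coord i x = q]] th r0].
Proof.
move=> [i ix0 hx0]; have [m [k [d cb]]] := exists_chart_ball g ix0.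
have [m0 k0 d0 _ _] := cb.
set p := coord i x0 in cb hx0 *.
have /nbhs_ballP[d1 /= d10 d1P] : nbhs p (@half_space_interior R n).
  by apply: open_nbhs_nbhs; split => //; exact: open_half_space_interior.
pose d2 := Num.min d d1.
have d20 : 0 < d2 by rewrite lt_min d0.
have d2d : d2 <= d by rewrite ge_min lexx.
have int q : `|p - q| < d2 -> half_space_interior q.
  by rewrite lt_min => /andP[_ pq]; apply: d1P; rewrite -ball_normE.
(* [k * th <= m / 2] makes reaching the exit point from inside the hole cost at most half of the
   length already spent; [th <= 1] keeps the hole in the chart ball. *)
pose th := Num.min (m / (2 * k)) 1.
have th0 : 0 < th by rewrite lt_min ltr01 divr_gt0// mulr_gt0.
have th1 : th <= 1 by rewrite ge_min lexx orbT.
have kth : k * th <= m / 2.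
  have : th <= m / (2 * k) by rewrite ge_min lexx.
  rewrite -(ler_pM2l k0) => /le_trans; apply.
  by rewrite le_eqVlt; apply/orP; left; apply/eqP; field; rewrite gt_eqF.
(* For [q] within [d2 / 8] of [p], the ball of radius [d2 / 2] about [q] lies in that of radius [d2]
   about [p]. With [r <= d2 / 8] it also contains the sphere of radius [r] and the holes around its
   points. *)
exists i, th, (d2 / 8); split => //; first by rewrite divr_gt0.
move=> q r [pq [x [[[y Gy xy] nox] ix xq]]] /andP[r0 rd].
have qd w : `|q - w| < d2 / 2 -> `|p - w| < d2.
  move=> qw; rewrite -(subrKA q) (le_lt_trans (ler_normD _ _))//; lra.
have cbq : chart_ball g i q m k (d2 / 2).
  apply: chart_ball_sub cb _ _; first by rewrite divr_gt0.
  by move: pq d2d => /ltW; lra.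
have hs w : `|q - w| < d2 / 2 -> half_space w.
  by move=> /qd/int; exact: half_space_interior_sub.
have rd2 : 0 < r < d2 / 2 by rewrite r0/=; lra.
have mr0 : 0 < m * r / 2 by rewrite divr_gt0// mulr_gt0.
have [c [pc c0 c1 cL]] : exists c, [/\ piecewise_smooth_on X c 0 1, c 0 = x, c 1 = y &
    (length_on g c 0 1 < (tau y + m * r / 2)%:E)%E].
  by apply: length_lt_of_dist_lt; apply: (le_lt_trans xy); rewrite lte_fin ltrDl.
(* The coordinate ball consists of interior points, while [y] lies in the closure of [Gamma] and is
   not interior. *)
have nc1 : ~ (dom i (c 1) /\ `|q - coord i (c 1)| <= r).
  rewrite c1 => -[iy qy]; apply: (manifold_interior_closure g Gamma_sub Gy).
  exists i => //; apply: int; apply: qd; apply: (le_lt_trans qy).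
  by case/andP: rd2.
have [||t [/andP[t0 t1] inb ctr]] := exit_time cbq rd2 hs pc _ _ nc1; rewrite ?c0//.
have t0t : 0 <= t <= t by rewrite (ltW t0) lexx.
have [ict _] := inb t t0t.
exists (coord i (c t)); first by rewrite distrC ctr.
move=> w wz [_ [x' [[_ nox'] ix' x'w]]]; apply: nox'.
apply: (open_influence_closure tau_cont Gy).
have r_lt : r < d2 / 2 by case/andP: rd2.
have qct : `|q - coord i (c t)| < d2 / 2 by rewrite ctr.
have thr : th * r <= r by rewrite ler_piMl// ltW.
have qx' : `|q - coord i x'| < d2 / 2.
  rewrite x'w -(subrKA (coord i (c t))) (le_lt_trans (ler_normD _ _))//.
  by rewrite ctr distrC; have := le_trans wz thr; lra.
have t01 : 0 < t <= 1 by rewrite t0 ltW.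
have := dist_replace_start cbq pc t01 ict qct ix' qx'.
rewrite c1 x'w => /le_lt_trans; apply.
have [|p1 p2] := piecewise_smooth_split pc (t := t); first by rewrite !ltW.
have L1 : ((m * r)%:E <= length_on g c 0 t)%E.
  have := @length_on_ge _ _ _ _ g 0 t c i m p1 m0 (fun s st => (inb s st).1) _.
  rewrite c0 xq distrC ctr; apply => s v /inb[ics cs].
  have [_ _ _ _ /(_ (c s) v ics)] := cbq.
  by move=> /(_ (le_lt_trans cs r_lt))/andP[].
move: cL; rewrite (length_on_cat g p1 p2) => cL.
(* After the exit, less than [tau y - m * r / 2] of length remains, and the segment from [x'] to
   [c t] costs at most [m * r / 2]. *)
have L12 := le_lt_trans (leeD2r (length_on g c t 1) L1) cL.
have kw : k * `|coord i (c t) - w| <= m * r / 2.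
  rewrite distrC; apply: (@le_trans _ _ (k * (th * r))); first by rewrite ler_wpM2l// ltW.
  by rewrite mulrA -(mulrAC m) ler_wpM2r// ltW.
move: L12 (length_on_ge0 g c t 1); case: (length_on g c t 1) => [l| |]//=.
by rewrite -!EFinD !lte_fin => Ll _; lra.
Qed.

End porosity.


(** * Null sets of the Riemannian volume *)

Section volume.
Variables (R : realType) (n : nat) (M : ptopologicalType).
Variables (X : smooth_manifold R n M) (g : riemannian_metric X).
Implicit Types (i j : chart X).

Lemma measurable_coord i :
  measurable_fun (dom i : set (borel M)) (coord i : borel M -> borel 'rV[R]_n).
Proof.
apply: (@measurability _ _ (borel M) (borel 'rV[R]_n) (dom i) (coord i)
  (@open 'rV[R]_n)) => // _ [U oU <-].
apply: borel_open; rewrite openE => x [ix Ux]; apply: filterI.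
  by apply: open_nbhs_nbhs; split => //; exact: dom_open.
by apply: (coord_continuous_at ix); exact: open_nbhs_nbhs.
Qed.

(** A Borel null set [F] containing the coordinates of [D] pulls back to a Borel set [A] containing
    [D], whose volume is an integral over a part of [F]. The image of [A] is Borel because the chart
    image is relatively open in the closed half-space. *)
Lemma negligible_chart (vol : {measure set (borel M) -> \bar R})
    (lam : {measure set (borel 'rV[R]_n) -> \bar R}) i (D : set M) :
  (forall A : set (borel M), measurable A -> A `<=` dom i ->
    vol A = (\int[lam]_(q in (coord i @` A : set (borel 'rV[R]_n)))
               (Num.sqrt (\det (tensor g i q)))%:E)%E) ->
  D `<=` dom i -> lam.-negligible (coord i @` D : set (borel 'rV[R]_n)) ->
  vol.-negligible (D : set (borel M)).
Proof.
move=> volE Di [F [mF F0 DF]].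
pose A : set (borel M) := dom i `&` coord i @^-1` F.
have mA : measurable A.
  by apply: measurable_coord => //; apply: borel_open; exact: dom_open.
have [U oU UE] := @coord_open _ _ _ X i (dom i) (dom_open i) (@subset_refl _ _).
have AE : coord i @` A = F `&` (coord i @` dom i).
  apply/seteqP; split => [_ [x [ix Fx] <-]|q [Fx [x ix xq]]].
    by split => //; exists x.
  by exists x => //; split => //=; rewrite xq.
have mH : measurable (@half_space R n : set (borel 'rV[R]_n)).
  apply: borel_closed.
  rewrite (_ : @half_space R n = \bigcap_(k in [set k : 'I_n | k = 0%N :> nat])
    [set q : 'rV[R]_n | 0 <= q ord0 k]); last by apply/seteqP; split.
  apply: closed_bigI => k _.
  apply: (@closed_comp _ _ (fun q : 'rV[R]_n => q ord0 k) [set s | 0 <= s]);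
    last exact: closed_ge.
  by move=> q _; exact: matrix_normedtype.coord_continuous.
have mcA : measurable (coord i @` A : set (borel 'rV[R]_n)).
  rewrite AE UE; apply: measurableI => //; apply: measurableI => //.
  exact: borel_open.
exists A; split => //; last first.
  by move=> x Dx; split; [exact: Di|apply: DF; exists x].
rewrite volE//; last by move=> x [].
apply: null_set_integral_ge0 => //.
by apply/eqP; rewrite eq_le measure_ge0 andbT -F0; apply: le_measure; rewrite ?inE// AE.
Qed.

Lemma not_interior_half_space_boundary i x : dom i x -> ~ manifold_interior X x ->
  half_space_boundary (coord i x).
Proof.
move=> ix nx; apply: contrapT => nb; apply: nx; exists i => // k k0.
rewrite lt_neqAle (coord_half_space ix k0) andbT; apply/eqP => xk.
by apply: nb; exists k.
Qed.

(** Locally in a chart, points that are not interior have coordinates in [half_space_boundary], a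
    Lebesgue null set. *)
Lemma negligible_manifold_boundary (vol : {measure set (borel M) -> \bar R}) :
  is_riemannian_volume g vol -> vol.-negligible (~` manifold_interior X : set (borel M)).
Proof.
move=> [lam lamE volE]; apply: negligible_local; first exact: (manifold_second_countable X).
move=> x nx; have [i ix] := dom_cover X x; exists (dom i).
  by apply: open_nbhs_nbhs; split => //; exact: dom_open.
apply: (negligible_chart (volE i)); first by move=> y [].
apply: negligibleS (half_space_boundary_negligible lamE) => _ [y [ny iy] <-].
exact: not_interior_half_space_boundary.
Qed.

End volume.

Theorem mainTheorem6 (R : realType) (n : nat) (hn : (2 <= n)%N)
    (M : ptopologicalType) (X : smooth_manifold R n M)
    (g : riemannian_metric X)
    (hcompact : compact [set: M]) (hconnected : connected [set: M])
    (hboundary : manifold_boundary X !=set0)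
    (vol : {measure set (borel M) -> \bar R})
    (hvol : is_riemannian_volume g vol)
    (Gamma : set M) (hGamma : Gamma `<=` manifold_boundary X)
    (hGamma_open : exists2 U : set M,
       open U & Gamma = U `&` manifold_boundary X)
    (tau : M -> R) (htau : {within closure Gamma, continuous tau}) :
  vol.-negligible (closed_influence g Gamma tau `\` open_influence g Gamma tau)
  /\ vol.-negligible (topological_boundary (closed_influence g Gamma tau)).
Proof.
suff null : vol.-negligible
    (closed_influence g Gamma tau `\` open_influence g Gamma tau).
  split => //; apply: negligibleS null.
  exact: (boundary_influence_sub htau hcompact).
set E := _ `\` _.
have null_int : vol.-negligible (E `&` manifold_interior X : set (borel M)).
  apply: negligible_local; first exact: (manifold_second_countable X).
  move=> x [_ /(influence_difference_porous g htau hGamma)].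
  move=> [i [th [r0 [ix th0 r00 por]]]].
  exists [set y | dom i y /\ `|coord i x - coord i y| < r0]; first exact: chart_nbhs.
  have [lam lamE volE] := hvol.
  apply: (negligible_chart (volE i)); first by move=> y [_ []].
  (* The cube of side [2 * r0] is circumscribed about the coordinate ball of radius [r0]; a quarter
     of its side is [r0 / 2], a scale at which porosity holds. *)
  apply: negligibleS (porous_negligible lamE por th0 (s := 2 * r0)
    (a := coord i x - const_mx r0) _ _ _) => [_ [y [[Ey _] [iy xy]] <-]| | |q [xq _]].
  - by split => //; exists y.
  - by rewrite mulr_gt0.
  - by lra.
  - apply/cubeP => k; have := le_trans (ler_mx_norm_entry _ ord0 k) (ltW xq).
    by rewrite !mxE ler_norml => /andP[? ?]; apply/andP; split; lra.
apply: negligibleS (negligibleU null_int (negligible_manifold_boundary hvol)).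
by move=> x Ex; have [ix|nx] := pselect (manifold_interior X x); [left|right].
Qed.
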